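(* For any $\lambda,\mu\in\mathbb{C}$ one has $$\Phi_\lambda\star\Phi_\mu=\Phi_{\lambda+\mu}.$$ If $\lambda+\mu=0$, then $\Phi_{\lambda+\mu}=\Phi_0$ and $$\Phi_0(t)=\delta(t),$$ where $\delta(t)$ is the Dirac distribution.
   Context: For $\lambda\in\mathbb{C}$, $\Phi_\lambda(t):=\frac{t^{\lambda-1}}{\Gamma(\lambda)}$, where $t$ stands for $t_+$ (that is, $t_+=t$ for $t\ge 0$ and $t_+=0$ for $t<0$, so that everything is supported on $[0,\infty)$), and $\Gamma$ is the gamma function ($1/\Gamma$ is entire). The Laplace transform is $L(b)(p):=\int_0^\infty e^{-pt}b(t)\,dt$ when the integral converges. For $\mathrm{Re}\,\lambda>0$ one has $L(t^{\lambda-1})=\Gamma(\lambda)p^{-\lambda}$, i.e. $L(\Phi_\lambda)=p^{-\lambda}$. For other $\lambda$, where the integral diverges, $L(t^{\lambda-1})$ and $L(\Phi_\lambda)$ are defined by analytic continuation in $\lambda$, so $L(\Phi_\lambda)=p^{-\lambda}$ for all $\lambda\in\mathbb{C}$, and $\Phi_\lambda$ is understood as $L^{-1}(p^{-\lambda})$, with $L^{-1}(1)=\delta$. The convolution, formally $\Phi_\lambda\star b=\int_0^t\Phi_\lambda(t-s)b(s)\,ds$, is defined for all such $\lambda$ (including those for which the integral diverges classically) by its Laplace transform: $L(\Phi_\lambda\star b):=L(\Phi_\lambda)L(b)=p^{-\lambda}L(b)$, i.e. $\Phi_\lambda\star b:=L^{-1}\big(p^{-\lambda}L(b)\big)$,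 where $L^{-1}$ is the inverse of $L$ on its range ($L$ has trivial null-space). *)

(* Defs.v *)
From Stdlib Require Import Reals Lra Lia ClassicalEpsilon.
From Coquelicot Require Import Coquelicot.
Open Scope R_scope.

(** * Elementary complex functions *)

Definition Cexp (z : C) : C :=
  (exp (Re z) * cos (Im z), exp (Re z) * sin (Im z)).

(** [t_+^z], supported on the positive half-line. *)
Definition pow_plus (t : R) (z : C) : C :=
  if Rlt_dec 0 t then Cexp (z * RtoC (ln t))%C else RtoC 0.

(** The improper integral of a complex-valued function over [(0, +oo)]. *)
Definition is_int_0_infty (f : R -> C) (l : C) : Prop :=
  is_RInt_gen (V := C_R_NormedModule) f (at_right 0) (Rbar_locally p_infty) l.

(** Euler's integral; it is the gamma function only for [0 < Re z]. *)
Definition Gamma_int (z : C) : C :=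
  RInt_gen (V := C_R_CompleteNormedModule)
    (fun t => Cexp (- RtoC t) * pow_plus t (z - 1))%C
    (at_right 0) (Rbar_locally p_infty).

Fixpoint rising (z : C) (n : nat) : C :=
  match n with
  | O => RtoC 1
  | S m => (rising z m * (z + RtoC (INR m)))%C
  end.

(** The entire function [1 / Gamma], from
    [Gamma (z + n) = z (z + 1) ... (z + n - 1) Gamma z] with [n] the least
    natural number such that [0 < Re (z + n)]; [n = 0] when [0 < Re z]. *)
Definition rGamma (z : C) : C :=
  let n := Z.to_nat (up (- Re z)) in
  (rising z n / Gamma_int (z + RtoC (INR n)))%C.

Definition PhiFun (lambda : C) (t : R) : C :=
  (rGamma lambda * pow_plus t (lambda - 1))%C.

(** * Analytic continuation *)

Definition analytic_at (g : C -> C) (z0 : C) : Prop :=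
  exists (a : nat -> C) (r : R), 0 < r /\
    forall z : C, Cmod (z - z0)%C < r ->
      is_pseries (K := C_AbsRing) (V := C_NormedModule) a (z - z0)%C (g z).

Definition entire (g : C -> C) : Prop := forall z0 : C, analytic_at g z0.

(** * Laplace transform of functions *)

Definition is_LaplaceFun (b : R -> C) (p : C) (l : C) : Prop :=
  is_int_0_infty (fun t => Cexp (- p * RtoC t) * b t)%C l.

(** [L(Phi_lambda)(p)], for every complex [lambda]: the value at [lambda] of the
    entire function of [nu] which is the convergent integral
    [L(PhiFun nu)(p)] whenever [0 < Re nu]. *)
Definition LPhi (lambda : C) (p : C) : C :=
  epsilon (inhabits (RtoC 0)) (fun w =>
    exists g : C -> C,
      entire g /\
      (forall nu : C, 0 < Re nu -> is_LaplaceFun (PhiFun nu) p (g nu)) /\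
      g lambda = w).

(** * Tempered distributions supported on [[0, +oo)]

    They are the continuous linear functionals on the space of smooth
    functions which, together with all derivatives, decay rapidly on
    [[0, +oo)]. The seminorms only involve the values on [[0, +oo)], so
    continuity forces the support to lie there. *)

Definition CDerive_n (f : R -> C) (n : nat) (t : R) : C :=
  (Derive_n (fun s => Re (f s)) n t, Derive_n (fun s => Im (f s)) n t).

Definition smooth (f : R -> C) : Prop :=
  forall (n : nat) (t : R),
    ex_derive_n (fun s => Re (f s)) n t /\ ex_derive_n (fun s => Im (f s)) n t.

(** [B] bounds the seminorm [sup_(t >= 0, k <= N) (1 + t)^N |f^(k)(t)|]. *)
Definition seminorm_le (N : nat) (f : R -> C) (B : R) : Prop :=
  forall (k : nat) (t : R), (k <= N)%nat -> 0 <= t ->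
    (1 + t) ^ N * Cmod (CDerive_n f k t) <= B.

Record test := Test {
  test_fun :> R -> C;
  test_smooth : smooth test_fun;
  test_decay : forall N : nat, exists B : R, seminorm_le N test_fun B
}.

Record dist := Dist {
  pairing :> test -> C;
  dist_linear : forall (f g h : test) (a b : C),
    (forall t : R, h t = (a * f t + b * g t)%C) ->
    pairing h = (a * pairing f + b * pairing g)%C;
  dist_continuous : exists (N : nat) (M : R), forall (f : test) (B : R),
    seminorm_le N f B -> Cmod (pairing f) <= M * B
}.

(** The Dirac distribution. *)
Definition delta : dist.
Proof.
refine (Dist (fun f => f 0) _ _).
- intros f g h a b H; apply H.
- exists 0%nat, 1; intros f B H.
  specialize (H 0%nat 0 (le_n _) (Rle_refl _)).
  unfold CDerive_n, Re, Im in H; simpl in H.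
  rewrite <- (surjective_pairing (f 0)) in H; lra.
Defined.

(** * The exponentials as test functions *)

Definition half_plane : Type := {p : C | 0 < Re p}.

Lemma is_derive_Cexp (c z : C) (t : R) :
  is_derive (fun s => Re (c * Cexp (z * RtoC s))%C) t
    (Re (c * z * Cexp (z * RtoC t))%C) /\
  is_derive (fun s => Im (c * Cexp (z * RtoC s))%C) t
    (Im (c * z * Cexp (z * RtoC t))%C).
Proof.
destruct c as [c1 c2], z as [z1 z2]; unfold Cexp, Re, Im, Cmult; simpl.
split; auto_derive; trivial; unfold Rminus; ring.
Qed.

Lemma Derive_n_Cexp (z : C) (n : nat) (t : R) :
  Derive_n (fun s => Re (Cexp (z * RtoC s))) n t =
    Re (Cpow z n * Cexp (z * RtoC t))%C /\
  Derive_n (fun s => Im (Cexp (z * RtoC s))) n t =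
    Im (Cpow z n * Cexp (z * RtoC t))%C.
Proof.
revert t; induction n as [|n IH]; intros t.
- split; cbn [Derive_n Cpow]; now rewrite Cmult_1_l.
- destruct (is_derive_Cexp (Cpow z n) z t) as [H1 H2].
  replace (Cpow z (S n)) with (Cpow z n * z)%C by (simpl; ring).
  split; cbn [Derive_n]; (etransitivity;
    [ apply Derive_ext; intros s; apply (IH s) | now apply is_derive_unique ]).
Qed.

Lemma smooth_Cexp (z : C) : smooth (fun t => Cexp (z * RtoC t)).
Proof.
intros [|n] t; [now split|].
destruct (is_derive_Cexp (Cpow z n) z t) as [H1 H2].
split; cbn [ex_derive_n].
- eapply ex_derive_ext; [intros s; symmetry; apply Derive_n_Cexp|].
  eexists; exact H1.
- eapply ex_derive_ext; [intros s; symmetry; apply Derive_n_Cexp|].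
  eexists; exact H2.
Qed.

Lemma Cmod_Cexp (z : C) : Cmod (Cexp z) = exp (Re z).
Proof.
unfold Cmod, Cexp; cbn [fst snd].
replace ((exp (Re z) * cos (Im z)) ^ 2 + (exp (Re z) * sin (Im z)) ^ 2)
  with (Rsqr (exp (Re z))).
- apply sqrt_Rsqr, Rlt_le, exp_pos.
- assert (H := sin2_cos2 (Im z)); unfold Rsqr in *.
  transitivity (exp (Re z) * exp (Re z) *
    (sin (Im z) * sin (Im z) + cos (Im z) * cos (Im z))); [rewrite H|]; ring.
Qed.

Lemma poly_exp_bound (a : R) (N : nat) :
  0 < a -> exists M, forall t, 0 <= t -> (1 + t) ^ N * exp (- a * t) <= M.
Proof.
revert a; induction N as [|N IH]; intros a Ha.
- exists 1; intros t Ht; simpl; rewrite Rmult_1_l, <- exp_0.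
  destruct (Req_dec (- a * t) 0) as [E|E]; [rewrite E; lra|].
  apply Rlt_le, exp_increasing; nra.
- destruct (IH (a / 2) ltac:(lra)) as [M HM].
  exists ((1 + 2 / a) * M); intros t Ht.
  replace (- a * t) with (- (a / 2) * t + - (a / 2) * t) by field.
  rewrite exp_plus; simpl.
  assert (E1 : exp (a / 2 * t) * exp (- (a / 2) * t) = 1).
  { rewrite <- exp_plus.
    replace (a / 2 * t + - (a / 2) * t) with 0 by ring; apply exp_0. }
  assert (E2 : 1 + a / 2 * t <= exp (a / 2 * t)).
  { destruct (Req_dec (a / 2 * t) 0) as [E|E].
    - rewrite E, exp_0; lra.
    - now apply Rlt_le, exp_ineq1. }
  assert (P := exp_pos (- (a / 2) * t)).
  assert (Q : 0 < 2 / a) by (apply Rdiv_lt_0_compat; lra).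
  assert (E3 : (1 + t) * exp (- (a / 2) * t) <= 1 + 2 / a).
  { assert (E4 : 1 + t <= (1 + 2 / a) * (1 + a / 2 * t)).
    { replace ((1 + 2 / a) * (1 + a / 2 * t))
        with (1 + t + 2 / a + a / 2 * t) by (field; lra); nra. }
    apply Rle_trans with
      ((1 + 2 / a) * exp (a / 2 * t) * exp (- (a / 2) * t)).
    - apply Rmult_le_compat_r; [lra|].
      apply Rle_trans with (1 := E4), Rmult_le_compat_l; lra.
    - rewrite Rmult_assoc, E1; lra. }
  specialize (HM t Ht).
  assert (R1 : 0 <= (1 + t) ^ N * exp (- (a / 2) * t)).
  { apply Rmult_le_pos; [apply pow_le|]; lra. }
  replace ((1 + t) * (1 + t) ^ N *
           (exp (- (a / 2) * t) * exp (- (a / 2) * t)))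
    with (((1 + t) * exp (- (a / 2) * t)) *
          ((1 + t) ^ N * exp (- (a / 2) * t))) by ring.
  apply Rmult_le_compat; trivial.
  apply Rmult_le_pos; lra.
Qed.

Lemma decay_Cexp (p : C) (N : nat) : 0 < Re p ->
  exists B, seminorm_le N (fun t => Cexp (- p * RtoC t)%C) B.
Proof.
intros Hp; destruct (poly_exp_bound (Re p) N Hp) as [M HM].
assert (P := Cmod_ge_0 p).
exists ((1 + Cmod p) ^ N * M); intros k t Hk Ht.
unfold CDerive_n.
destruct (Derive_n_Cexp (- p)%C k t) as [E1 E2]; rewrite E1, E2.
unfold Re at 1, Im at 1; rewrite <- surjective_pairing.
rewrite Cmod_mult, Cmod_pow, Cmod_opp, Cmod_Cexp.
replace (Re (- p * RtoC t)%C) with (- Re p * t)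
  by (destruct p; unfold Re, Copp, Cmult, RtoC; simpl; ring).
specialize (HM t Ht).
replace ((1 + t) ^ N * (Cmod p ^ k * exp (- Re p * t)))
  with (Cmod p ^ k * ((1 + t) ^ N * exp (- Re p * t))) by ring.
apply Rmult_le_compat; trivial.
- now apply pow_le.
- apply Rmult_le_pos; [apply pow_le; lra | apply Rlt_le, exp_pos].
- apply Rle_trans with ((1 + Cmod p) ^ k).
  + apply pow_incr; lra.
  + apply Rle_pow; [lra | exact Hk].
Qed.

Definition exp_test (p : half_plane) : test :=
  Test (fun t => Cexp (- proj1_sig p * RtoC t)%C)
    (smooth_Cexp (- proj1_sig p)%C)
    (fun N => decay_Cexp (proj1_sig p) N (proj2_sig p)).

(** * Laplace transform of distributions, convolution, [Phi] *)

Definition Laplace (T : dist) (p : half_plane) : C := T (exp_test p).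

(** The inverse of [Laplace] on its range (unspecified elsewhere). *)
Definition Laplace_inv (F : half_plane -> C) : dist :=
  epsilon (inhabits delta) (fun T => forall p : half_plane, Laplace T p = F p).

Definition star (a b : dist) : dist :=
  Laplace_inv (fun p => (Laplace a p * Laplace b p)%C).

Definition Phi (lambda : C) : dist :=
  Laplace_inv (fun p => LPhi lambda (proj1_sig p)).

(* Main.v *)
Require Import Defs.
From Stdlib Require Import Reals Lra Lia Psatz Factorial ClassicalEpsilon.
From Stdlib Require Import FunctionalExtensionality ProofIrrelevance.
From Coquelicot Require Import Coquelicot.
Open Scope R_scope.

(** Write [L] for the Laplace transform. On the half-plane [0 < Re p] one has
    [L(Phi_lambda)(p) = p^(-lambda)] for every complex [lambda], and the right
    side is multiplicative in [lambda]. So both members of the convolution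
    identity are the inverse transform of one function, and [Phi_0] and [delta]
    have the same transform, the constant 1. Three facts make this rigorous.

    The transform of [Phi_lambda] is [p^(-lambda)] ([LPhi_eq]). For
    [0 < Re lambda] the function [p^lambda L(t^(lambda - 1))(p)] is constant
    along a path from 1 to [p], because differentiation under the integral and
    integration by parts cancel each other ([power_Laplace_rotate]); its value
    at 1 is [Gamma lambda]. Dividing by [Gamma lambda] requires that it be
    nonzero ([Gamma_int_neq_0]): otherwise [t^(lambda - 1)] would be orthogonal
    to all exponentials [e^(-jt)], hence by density to all rapidly decreasing
    functions. The value at the other [lambda] follows since an entire function
    is determined by its values on a half-plane ([entire_half_plane_unique]).

    A distribution with this transform exists ([power_dist_exists]): the [n]-th
    distributional derivative of the function [Phi_(lambda + n)] for [n] large.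

    The transform is injective on distributions ([Laplace_injective]). A
    distribution is bounded by some seminorm of order [N], and the exponential
    sums are dense for that seminorm: substituting [x = e^(-t)] turns the uniform
    approximation of the [N]-th derivative of a test function by exponential
    sums into Bernstein's proof of the Weierstrass theorem ([exp_sums_dense]),
    and the lower derivatives are recovered by integrating from infinity
    ([seminorm_of_top_derivative]). *)

(** * Calculus of complex-valued functions of a real variable *)

(** Derivatives and continuity are taken separately on the real and imaginary
    parts, in accordance with [CDerive_n] and [smooth], and so that the order
    arguments of real analysis apply directly. *)
Definition Cderiv (f : R -> C) (t : R) (d : C) : Prop :=
  is_derive (fun s => Re (f s)) t (Re d) /\
  is_derive (fun s => Im (f s)) t (Im d).

Definition Ccont (f : R -> C) (t : R) : Prop :=
  continuous (fun s => Re (f s)) t /\ continuous (fun s => Im (f s)) t.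

Lemma C_eq (z w : C) : Re z = Re w -> Im z = Im w -> z = w.
Proof. destruct z, w; unfold Re, Im; simpl; congruence. Qed.

Lemma Im_le_Cmod (z : C) : Rabs (Im z) <= Cmod z.
Proof.
apply Rle_trans with (2 := Rmax_Cmod z), Rmax_r.
Qed.

Lemma Cmod_le_Re_Im (z : C) : Cmod z <= Rabs (Re z) + Rabs (Im z).
Proof.
destruct z as [x y]; unfold Re, Im; simpl.
replace (x, y) with (RtoC x + Ci * RtoC y)%C
  by (apply C_eq; simpl; unfold Re, Im, RtoC, Ci; simpl; ring).
apply Rle_trans with (1 := Cmod_triangle _ _).
rewrite Cmod_mult, Cmod_Ci, !Cmod_R; lra.
Qed.

Lemma Cderiv_cont f t d : Cderiv f t d -> Ccont f t.
Proof.
intros [H1 H2]; split; apply (@ex_derive_continuous R_AbsRing R_NormedModule);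
  eexists; eassumption.
Qed.

Lemma Cderiv_ext_loc f g t d :
  locally t (fun s => f s = g s) -> Cderiv f t d -> Cderiv g t d.
Proof.
intros E [H1 H2]; split; [revert H1 | revert H2]; apply is_derive_ext_loc;
  revert E; apply filter_imp; intros s E; now rewrite E.
Qed.

Lemma Cderiv_mult f g t df dg :
  Cderiv f t df -> Cderiv g t dg ->
  Cderiv (fun s => f s * g s)%C t (df * g t + f t * dg)%C.
Proof.
intros [f1 f2] [g1 g2]; split.
- eapply is_derive_ext with
    (f := fun s => Re (f s) * Re (g s) - Im (f s) * Im (g s)); [reflexivity|].
  replace (Re (df * g t + f t * dg)%C) with
    (minus (plus (Re df * Re (g t)) (Re (f t) * Re dg))
      (plus (Im df * Im (g t)) (Im (f t) * Im dg)))
    by (unfold minus, plus, opp, Re, Im; simpl; ring).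
  apply (@is_derive_minus R_AbsRing R_NormedModule);
    apply Derive.is_derive_mult; assumption.
- eapply is_derive_ext with
    (f := fun s => Re (f s) * Im (g s) + Im (f s) * Re (g s)); [reflexivity|].
  replace (Im (df * g t + f t * dg)%C) with
    (plus (plus (Re df * Im (g t)) (Re (f t) * Im dg))
      (plus (Im df * Re (g t)) (Im (f t) * Re dg)))
    by (unfold plus, Re, Im; simpl; ring).
  apply (@is_derive_plus R_AbsRing R_NormedModule);
    apply Derive.is_derive_mult; assumption.
Qed.

Lemma Ccont_mult f g t : Ccont f t -> Ccont g t -> Ccont (fun s => f s * g s)%C t.
Proof.
intros [f1 f2] [g1 g2]; split; simpl.
- apply (@continuous_minus _ _ R_NormedModule
    (fun s => Re (f s) * Re (g s)) (fun s => Im (f s) * Im (g s)));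
    apply (@continuous_mult R_UniformSpace R_AbsRing); assumption.
- apply (@continuous_plus _ _ R_NormedModule
    (fun s => Re (f s) * Im (g s)) (fun s => Im (f s) * Re (g s)));
    apply (@continuous_mult R_UniformSpace R_AbsRing); assumption.
Qed.

Lemma Ccont_plus f g t : Ccont f t -> Ccont g t -> Ccont (fun s => f s + g s)%C t.
Proof.
intros [f1 f2] [g1 g2]; split; simpl.
- now apply (@continuous_plus _ _ R_NormedModule
    (fun s => Re (f s)) (fun s => Re (g s))).
- now apply (@continuous_plus _ _ R_NormedModule
    (fun s => Im (f s)) (fun s => Im (g s))).
Qed.

Lemma Ccont_const c t : Ccont (fun _ => c) t.
Proof. split; apply continuous_const. Qed.

Lemma Ccont_RtoC f t : continuous f t -> Ccont (fun s => RtoC (f s)) t.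
Proof. split; [assumption|]. apply continuous_const. Qed.

Lemma Ccont_ext_loc f g t :
  locally t (fun s => f s = g s) -> Ccont f t -> Ccont g t.
Proof.
intros E [H1 H2]; split;
  [ apply continuous_ext_loc with (fun s => Re (f s))
  | apply continuous_ext_loc with (fun s => Im (f s)) ]; trivial;
  revert E; apply filter_imp; intros s E; now rewrite E.
Qed.

Lemma locally_pos t : 0 < t -> locally t (fun s => 0 < s).
Proof. intros Ht; apply (open_gt 0 t Ht). Qed.

(** * Improper integrals over the half-line *)

Lemma is_int_components f l :
  is_int_0_infty f l <->
  is_RInt_gen (fun t => Re (f t)) (at_right 0) (Rbar_locally p_infty) (Re l) /\
  is_RInt_gen (fun t => Im (f t)) (at_right 0) (Rbar_locally p_infty) (Im l).
Proof.
split.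
- intros H; split; intros P [eps He].
  + assert (A : locally (l : C_R_NormedModule) (fun y => P (Re y))).
    { exists eps; intros y [Hy _]; now apply He. }
    generalize (H _ A); unfold filtermapi; apply filter_imp; intros ab [y [H1 H2]].
    exists (Re y); split; trivial.
    now apply (is_RInt_fct_extend_fst (U := R_NormedModule) (V := R_NormedModule)).
  + assert (A : locally (l : C_R_NormedModule) (fun y => P (Im y))).
    { exists eps; intros y [_ Hy]; now apply He. }
    generalize (H _ A); unfold filtermapi; apply filter_imp; intros ab [y [H1 H2]].
    exists (Im y); split; trivial.
    now apply (is_RInt_fct_extend_snd (U := R_NormedModule) (V := R_NormedModule)).
- intros [H1 H2] P [eps He].
  assert (A1 := H1 _ (locally_ball _ eps)).
  assert (A2 := H2 _ (locally_ball _ eps)).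
  unfold filtermapi in A1, A2 |- *.
  generalize (filter_and _ _ A1 A2); apply filter_imp; intros ab [[y1 [I1 B1]] [y2 [I2 B2]]].
  exists (y1, y2); split.
  + now apply (is_RInt_fct_extend_pair (U := R_NormedModule) (V := R_NormedModule)).
  + apply He; now split.
Qed.

Lemma RInt_gen_of_is_int f l :
  is_int_0_infty f l ->
  RInt_gen (V := C_R_CompleteNormedModule) f (at_right 0) (Rbar_locally p_infty) = l.
Proof.
exact (@is_RInt_gen_unique C_R_CompleteNormedModule (at_right 0)
  (Rbar_locally p_infty) _ _ f l).
Qed.

Lemma is_int_unique f l l' : is_int_0_infty f l -> is_int_0_infty f l' -> l = l'.
Proof. intros H H'; rewrite <- (RInt_gen_of_is_int _ _ H); now apply RInt_gen_of_is_int. Qed.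

Lemma half_line_pos :
  filter_prod (at_right 0) (Rbar_locally p_infty)
    (fun ab : R * R => 0 < fst ab <= snd ab).
Proof.
apply (Filter_prod _ _ _ (fun x => 0 < x < 1) (fun y => 1 < y)).
- exists (mkposreal 1 Rlt_0_1); intros y Hy Hy'.
  unfold ball in Hy; simpl in Hy; unfold AbsRing_ball, abs, minus, plus, opp in Hy;
    simpl in Hy; apply Rabs_def2 in Hy; lra.
- now exists 1.
- simpl; intros; lra.
Qed.

Lemma is_int_ext f g l :
  (forall t, 0 < t -> f t = g t) -> is_int_0_infty f l -> is_int_0_infty g l.
Proof.
intros E; apply (@is_RInt_gen_ext C_R_NormedModule (at_right 0)
  (Rbar_locally p_infty) _ _ f g l).
generalize half_line_pos; apply filter_imp; intros ab Hab x Hx.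
apply E; rewrite Rmin_left in Hx; lra.
Qed.

Lemma is_int_lin f g lf lg a b :
  is_int_0_infty f lf -> is_int_0_infty g lg ->
  is_int_0_infty (fun t => a * f t + b * g t)%C (a * lf + b * lg)%C.
Proof.
intros Hf Hg; apply is_int_components in Hf, Hg.
destruct Hf as [f1 f2], Hg as [g1 g2]; apply is_int_components; split.
- pose proof (is_RInt_gen_plus _ _ _ _
   (is_RInt_gen_minus _ _ _ _ (is_RInt_gen_scal _ (Re a) _ f1)
     (is_RInt_gen_scal _ (Im a) _ f2))
   (is_RInt_gen_minus _ _ _ _ (is_RInt_gen_scal _ (Re b) _ g1)
     (is_RInt_gen_scal _ (Im b) _ g2))) as H.
  replace (Re (a * lf + b * lg)%C) with
    (plus (minus (scal (Re a) (Re lf)) (scal (Im a) (Im lf)))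
      (minus (scal (Re b) (Re lg)) (scal (Im b) (Im lg)))); [exact H|].
  unfold minus, plus, scal, opp, Re, Im; simpl; unfold mult; simpl; ring.
- pose proof (is_RInt_gen_plus _ _ _ _
   (is_RInt_gen_plus _ _ _ _ (is_RInt_gen_scal _ (Re a) _ f2)
     (is_RInt_gen_scal _ (Im a) _ f1))
   (is_RInt_gen_plus _ _ _ _ (is_RInt_gen_scal _ (Re b) _ g2)
     (is_RInt_gen_scal _ (Im b) _ g1))) as H.
  replace (Im (a * lf + b * lg)%C) with
    (plus (plus (scal (Re a) (Im lf)) (scal (Im a) (Re lf)))
      (plus (scal (Re b) (Im lg)) (scal (Im b) (Re lg)))); [exact H|].
  unfold minus, plus, scal, opp, Re, Im; simpl; unfold mult; simpl; ring.
Qed.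

Lemma is_int_0 : is_int_0_infty (fun _ => RtoC 0) (RtoC 0).
Proof.
assert (H : is_RInt_gen (fun _ : R => 0) (at_right 0) (Rbar_locally p_infty) 0).
{ intros P HP; unfold filtermapi; apply filter_forall; intros ab; exists 0; split.
  - pose proof (@is_RInt_const R_NormedModule (fst ab) (snd ab) 0) as H.
    exact (eq_ind _ (is_RInt _ _ _) H 0 (Rmult_0_r (snd ab - fst ab))).
  - now apply locally_singleton. }
apply is_int_components; split; exact H.
Qed.

Lemma is_int_scal f l c :
  is_int_0_infty f l -> is_int_0_infty (fun t => c * f t)%C (c * l)%C.
Proof.
intros H; pose proof (is_int_lin _ _ _ _ c (RtoC 0) H is_int_0) as H'.
replace (c * l)%C with (c * l + RtoC 0 * RtoC 0)%C by ring.
revert H'; apply is_int_ext; intros; ring.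
Qed.

Lemma RInt_gen_antideriv (F f : R -> R) (la lb : R) :
  (forall t, 0 < t -> is_derive F t (f t)) ->
  (forall t, 0 < t -> continuous f t) ->
  filterlim F (at_right 0) (locally la) ->
  filterlim F (Rbar_locally p_infty) (locally lb) ->
  is_RInt_gen f (at_right 0) (Rbar_locally p_infty) (lb - la).
Proof.
intros HF Hf La Lb.
assert (P := half_line_pos).
apply is_RInt_gen_ext with (Derive F).
{ revert P; apply filter_imp; intros ab Hab x Hx.
  apply is_derive_unique, HF; rewrite Rmin_left in Hx; lra. }
apply is_RInt_gen_Derive; trivial; revert P; apply filter_imp; intros ab Hab x Hx;
  rewrite Rmin_left in Hx by lra.
- eexists; apply HF; lra.
- apply continuous_ext_loc with f; [|apply Hf; lra].
  apply (filter_imp (fun s => 0 < s)); [|apply locally_pos; lra].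
  intros s Hs; symmetry; now apply is_derive_unique, HF.
Qed.

Lemma is_int_antideriv (F f : R -> C) (la lb : C) :
  (forall t, 0 < t -> Cderiv F t (f t)) ->
  (forall t, 0 < t -> Ccont f t) ->
  filterlim (fun t => Re (F t)) (at_right 0) (locally (Re la)) ->
  filterlim (fun t => Im (F t)) (at_right 0) (locally (Im la)) ->
  filterlim (fun t => Re (F t)) (Rbar_locally p_infty) (locally (Re lb)) ->
  filterlim (fun t => Im (F t)) (Rbar_locally p_infty) (locally (Im lb)) ->
  is_int_0_infty f (lb - la)%C.
Proof.
intros HF Hf L1 L2 L3 L4; apply is_int_components; split; simpl.
- apply RInt_gen_antideriv with (fun t => Re (F t)); trivial; intros t Ht.
  + exact (proj1 (HF t Ht)).
  + exact (proj1 (Hf t Ht)).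
- apply RInt_gen_antideriv with (fun t => Im (F t)); trivial; intros t Ht.
  + exact (proj2 (HF t Ht)).
  + exact (proj2 (Hf t Ht)).
Qed.

(** ** Domination by [M / (1 + t)^2] *)

Lemma lim_inv_1p :
  filterlim (fun t => - / (1 + t)) (Rbar_locally p_infty) (locally 0).
Proof.
replace (locally 0) with (Rbar_locally (Rbar_opp (Rbar_inv p_infty)))
  by (simpl; now rewrite Ropp_0).
apply (is_lim_opp (fun t => / (1 + t)) p_infty).
apply is_lim_inv; [|discriminate].
eapply is_lim_plus; [apply is_lim_const | apply is_lim_id | reflexivity].
Qed.

Lemma is_derive_inv_1p t : 0 <= t -> is_derive (fun s => - / (1 + s)) t (/ (1 + t) ^ 2).
Proof. intros Ht; auto_derive; [lra | field; lra]. Qed.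

Lemma continuous_inv_1p t : 0 <= t -> continuous (fun s => / (1 + s) ^ 2) t.
Proof.
intros Ht; apply (@ex_derive_continuous R_AbsRing R_NormedModule).
auto_derive; apply Rgt_not_eq; simpl; nra.
Qed.

Lemma RInt_gen_dominating M :
  is_RInt_gen (fun t => M * / (1 + t) ^ 2) (at_right 0) (Rbar_locally p_infty) M.
Proof.
assert (H : is_RInt_gen (fun t => / (1 + t) ^ 2) (at_right 0)
  (Rbar_locally p_infty) (0 - (- / (1 + 0)))).
{ apply RInt_gen_antideriv with (fun s => - / (1 + s)).
  - intros t Ht; apply is_derive_inv_1p; lra.
  - intros t Ht; apply continuous_inv_1p; lra.
  - eapply filterlim_filter_le_1; [apply filter_le_within|].
    apply (@ex_derive_continuous R_AbsRing R_NormedModule (fun s => - / (1 + s))).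
    eexists; apply is_derive_inv_1p; lra.
  - apply lim_inv_1p. }
pose proof (is_RInt_gen_scal _ M _ H) as H'.
assert (E : M * (0 - - / (1 + 0)) = M) by field.
exact (eq_ind _ (is_RInt_gen _ _ _) H' M E).
Qed.

Lemma RInt_dominated (f : R -> R) (M : R) (x y : R) :
  (forall t, 0 < t -> continuous f t) ->
  (forall t, 0 < t -> Rabs (f t) <= M * / (1 + t) ^ 2) ->
  0 < x -> x <= y ->
  Rabs (RInt f x y) <= M * (/ (1 + x) - / (1 + y)).
Proof.
intros Hf Hb Hx Hxy.
apply (norm_RInt_le f (fun t => M * / (1 + t) ^ 2) x y); trivial.
- intros t Ht; apply Hb; lra.
- apply (@RInt_correct R_CompleteNormedModule), ex_RInt_continuous.
  intros z; rewrite Rmin_left by lra; intros Hz; apply Hf; lra.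
- replace (M * (/ (1 + x) - / (1 + y))) with
    (scal M (minus (- / (1 + y)) (- / (1 + x))))
    by (unfold scal, minus, opp, plus; simpl; unfold mult; simpl; ring).
  apply (@is_RInt_scal R_NormedModule).
  apply (is_RInt_derive (fun s => - / (1 + s)) (fun s => / (1 + s) ^ 2));
    intros z; rewrite Rmin_left by lra; intros Hz.
  + apply is_derive_inv_1p; lra.
  + apply continuous_inv_1p; lra.
Qed.

(** The primitive [F] of [f] based at 1 satisfies the Cauchy criterion at both
    ends of the half-line, since its increments are at most those of
    [- M / (1 + x)]. *)
Lemma ex_RInt_gen_dominated (f : R -> R) (M : R) :
  (forall t, 0 < t -> continuous f t) ->
  (forall t, 0 < t -> Rabs (f t) <= M * / (1 + t) ^ 2) ->
  exists l, is_RInt_gen f (at_right 0) (Rbar_locally p_infty) l.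
Proof.
intros Hf Hb.
set (F := fun x => RInt f 1 x).
assert (Hex : forall x y, 0 < x -> 0 < y -> ex_RInt f x y).
{ intros x y Hx Hy; apply (@ex_RInt_continuous R_CompleteNormedModule).
  intros z [Hz _]; apply Hf.
  assert (0 < Rmin x y) by now apply Rmin_glb_lt. lra. }
assert (M0 : 0 <= M).
{ specialize (Hb 1 Rlt_0_1); assert (H := Rabs_pos (f 1)).
  assert (0 < / (1 + 1) ^ 2) by (apply Rinv_0_lt_compat; lra). nra. }
assert (HF : forall x y, 0 < x -> x <= y ->
  Rabs (F y - F x) <= M * (/ (1 + x) - / (1 + y))).
{ intros x y Hx Hy; unfold F.
  replace (RInt f 1 y - RInt f 1 x) with (RInt f x y).
  - apply RInt_dominated; trivial.
  - assert (E : RInt f 1 x + RInt f x y = RInt f 1 y)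
      by (apply (RInt_Chasles f 1 x y); apply Hex; lra).
    lra. }
assert (HD : forall t, 0 < t -> is_derive F t (f t)).
{ intros t Ht; apply (is_derive_RInt f F 1); [|now apply Hf].
  apply (filter_imp (fun s => 0 < s)); [|now apply locally_pos].
  intros s Hs; apply (@RInt_correct R_CompleteNormedModule), Hex; lra. }
assert (L0 : exists l, filterlim F (at_right 0) (locally l)).
{ apply filterlim_locally_cauchy; intros eps.
  assert (Hd : 0 < eps / (M + 1))
    by (apply Rdiv_lt_0_compat; [apply cond_pos | lra]).
  exists (fun x => 0 < x < eps / (M + 1)); split.
  - exists (mkposreal _ Hd); intros y Hy Hy'.
    unfold ball in Hy; simpl in Hy; unfold AbsRing_ball, abs, minus, plus, opp in Hy;
    simpl in Hy; apply Rabs_def2 in Hy; lra.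
  - assert (A : forall u v, 0 < u < eps / (M + 1) -> 0 < v < eps / (M + 1) ->
      u <= v -> Rabs (F v - F u) < eps).
    { intros u v Hu Hv Huv; apply Rle_lt_trans with (1 := HF u v ltac:(lra) Huv).
      assert (B : / (1 + u) - / (1 + v) <= v).
      { assert (/ (1 + u) <= 1) by (rewrite <- Rinv_1; apply Rinv_le_contravar; lra).
        assert (1 - v <= / (1 + v)).
        { apply Rmult_le_reg_r with (1 + v); [lra|]; rewrite Rinv_l; nra. }
        lra. }
      assert (v * (M + 1) < eps).
      { apply Rmult_lt_reg_r with (/ (M + 1)); [apply Rinv_0_lt_compat; lra|].
        rewrite Rmult_assoc, Rinv_r by lra. unfold Rdiv in Hv; lra. }
      assert (M * (/ (1 + u) - / (1 + v)) <= M * v)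
        by now apply Rmult_le_compat_l.
      nra. }
    intros u v Hu Hv; change (Rabs (F v - F u) < eps).
    destruct (Rle_dec u v) as [H|H]; [now apply A|].
    rewrite Rabs_minus_sym; apply A; trivial; lra. }
assert (L1 : exists l, filterlim F (Rbar_locally p_infty) (locally l)).
{ apply filterlim_locally_cauchy; intros eps.
  exists (fun x => 0 < x /\ M / eps < x); split.
  - exists (Rmax 0 (M / eps)); intros x Hx; split;
      [ apply Rle_lt_trans with (2 := Hx), Rmax_l
      | apply Rle_lt_trans with (2 := Hx), Rmax_r ].
  - assert (Pe := cond_pos eps).
    assert (A : forall u v, 0 < u /\ M / eps < u -> 
      u <= v -> Rabs (F v - F u) < eps).
    { intros u v [Hu Hu'] Huv; apply Rle_lt_trans with (1 := HF u v Hu Huv).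
      assert (0 < / (1 + v)) by (apply Rinv_0_lt_compat; lra).
      apply Rle_lt_trans with (M * / (1 + u)).
      - apply Rmult_le_compat_l; lra.
      - apply Rmult_lt_reg_r with (1 + u); [lra|].
        rewrite Rmult_assoc, Rinv_l by lra.
        assert (M / eps * eps < u * eps) by now apply Rmult_lt_compat_r.
        unfold Rdiv in H0; rewrite Rmult_assoc, Rinv_l in H0 by lra. lra. }
    intros u v Hu Hv; change (Rabs (F v - F u) < eps).
    destruct (Rle_dec u v) as [H|H]; [now apply A|].
    rewrite Rabs_minus_sym; apply A; trivial; lra. }
destruct L0 as [l0 L0], L1 as [l1 L1].
exists (l1 - l0); now apply RInt_gen_antideriv with F.
Qed.

Lemma is_int_dominated (f : R -> C) (M : R) :
  (forall t, 0 < t -> Ccont f t) ->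
  (forall t, 0 < t -> Cmod (f t) <= M * / (1 + t) ^ 2) ->
  exists l, is_int_0_infty f l /\ Cmod l <= M.
Proof.
intros Hf Hb.
destruct (ex_RInt_gen_dominated (fun t => Re (f t)) M) as [l1 H1].
{ intros t Ht; exact (proj1 (Hf t Ht)). }
{ intros t Ht; apply Rle_trans with (1 := re_le_Cmod _); now apply Hb. }
destruct (ex_RInt_gen_dominated (fun t => Im (f t)) M) as [l2 H2].
{ intros t Ht; exact (proj2 (Hf t Ht)). }
{ intros t Ht; apply Rle_trans with (1 := Im_le_Cmod _); now apply Hb. }
assert (H : is_int_0_infty f (l1, l2)) by (apply is_int_components; now split).
exists (l1, l2); split; [exact H|].
rewrite Cmod_norm.
apply (RInt_gen_norm (V := C_R_CompleteNormedModule) (Fa := at_right 0)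
  (Fb := Rbar_locally p_infty) f (fun t => M * / (1 + t) ^ 2) (l1, l2) M);
  [ | | exact H | apply RInt_gen_dominating];
  generalize half_line_pos; apply filter_imp; intros ab Hab.
- lra.
- intros x Hx; rewrite <- Cmod_norm; apply Hb; lra.
Qed.

(** * The complex exponential *)

Lemma Cexp_plus z w : Cexp (z + w)%C = (Cexp z * Cexp w)%C.
Proof.
apply C_eq; destruct z as [a b], w as [c d]; unfold Cexp, Re, Im; simpl;
  rewrite exp_plus; [rewrite cos_plus | rewrite sin_plus]; ring.
Qed.

Lemma Cexp_0 : Cexp (RtoC 0) = RtoC 1.
Proof.
apply C_eq; unfold Cexp, Re, Im, RtoC; simpl; rewrite exp_0, ?cos_0, ?sin_0; ring.
Qed.

Lemma Cexp_neq_0 z : Cexp z <> RtoC 0.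
Proof.
intros H; apply (f_equal Cmod) in H; rewrite Cmod_Cexp, Cmod_0 in H.
assert (P := exp_pos (Re z)); lra.
Qed.

Lemma Cexp_opp z : Cexp (- z)%C = (/ Cexp z)%C.
Proof.
assert (H : (Cexp (- z) * Cexp z)%C = RtoC 1).
{ rewrite <- Cexp_plus, <- Cexp_0; f_equal; ring. }
rewrite <- (Cmult_1_l (/ Cexp z)), <- H.
field; apply Cexp_neq_0.
Qed.

Lemma Cexp_mult_INR n z : Cexp (RtoC (INR n) * z)%C = Cpow (Cexp z) n.
Proof.
induction n as [|n IH].
- simpl. replace (RtoC 0 * z)%C with (RtoC 0) by ring. apply Cexp_0.
- rewrite S_INR, RtoC_plus; simpl; rewrite <- IH, <- Cexp_plus; f_equal; ring.
Qed.

Lemma Cderiv_Cexp g t d :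
  Cderiv g t d -> Cderiv (fun s => Cexp (g s)) t (d * Cexp (g t))%C.
Proof.
intros [H1 H2].
split; [ change (is_derive (fun s => exp (Re (g s)) * cos (Im (g s))) t
           (Re (d * Cexp (g t))%C))
       | change (is_derive (fun s => exp (Re (g s)) * sin (Im (g s))) t
           (Im (d * Cexp (g t))%C)) ];
  set (u := fun s => Re (g s)) in *; set (v := fun s => Im (g s)) in *.
- replace (Re (d * Cexp (g t))%C) with
    (Re d * exp (u t) * cos (v t) + exp (u t) * (Im d * - sin (v t)))
    by (unfold u, v, Cexp, Re, Im; simpl; ring).
  apply (Derive.is_derive_mult (fun s => exp (u s)) (fun s => cos (v s)) t
    (Re d * exp (u t)) (Im d * - sin (v t))).
  + apply (is_derive_comp (V := R_NormedModule) exp u); [apply is_derive_exp | exact H1].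
  + apply (is_derive_comp (V := R_NormedModule) cos v); [apply is_derive_cos | exact H2].
- replace (Im (d * Cexp (g t))%C) with
    (Re d * exp (u t) * sin (v t) + exp (u t) * (Im d * cos (v t)))
    by (unfold u, v, Cexp, Re, Im; simpl; ring).
  apply (Derive.is_derive_mult (fun s => exp (u s)) (fun s => sin (v s)) t
    (Re d * exp (u t)) (Im d * cos (v t))).
  + apply (is_derive_comp (V := R_NormedModule) exp u); [apply is_derive_exp | exact H1].
  + apply (is_derive_comp (V := R_NormedModule) sin v); [apply is_derive_sin | exact H2].
Qed.

Lemma Cderiv_scal_RtoC c u t du :
  is_derive u t du -> Cderiv (fun s => c * RtoC (u s))%C t (c * RtoC du)%C.
Proof.
intros H; split.
- apply is_derive_ext with (fun s => Re c * u s).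
  { intros s; unfold Re, RtoC; simpl; ring. }
  replace (Re (c * RtoC du)%C) with (Re c * du) by (unfold Re, RtoC; simpl; ring).
  now apply is_derive_scal.
- apply is_derive_ext with (fun s => Im c * u s).
  { intros s; unfold Im, RtoC; simpl; ring. }
  replace (Im (c * RtoC du)%C) with (Im c * du) by (unfold Im, RtoC; simpl; ring).
  now apply is_derive_scal.
Qed.

Lemma Cderiv_Cexp_linear z t :
  Cderiv (fun s => Cexp (z * RtoC s)) t (z * Cexp (z * RtoC t))%C.
Proof.
replace (z * Cexp (z * t))%C with (z * RtoC 1 * Cexp (z * t))%C by ring.
apply (Cderiv_Cexp (fun s => z * RtoC s)%C).
apply (Cderiv_scal_RtoC z (fun s => s)); apply (@is_derive_id R_AbsRing).
Qed.

Lemma Ccont_Cexp_linear z t : Ccont (fun s => Cexp (z * RtoC s)) t.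
Proof. eapply Cderiv_cont, Cderiv_Cexp_linear. Qed.

Lemma exp_le_compat x y : x <= y -> exp x <= exp y.
Proof. intros [H| ->]; [now apply Rlt_le, exp_increasing | apply Rle_refl]. Qed.

Definition exp_coef (k : nat) : R := / INR (fact k).

Lemma Re_sum_n (u : nat -> C) n : Re (sum_n u n) = sum_f_R0 (fun k => Re (u k)) n.
Proof.
induction n as [|n IH]; [now rewrite sum_O|].
rewrite sum_Sn; simpl; now rewrite <- IH.
Qed.

Lemma Im_sum_n (u : nat -> C) n : Im (sum_n u n) = sum_f_R0 (fun k => Im (u k)) n.
Proof.
induction n as [|n IH]; [now rewrite sum_O|].
rewrite sum_Sn; simpl; now rewrite <- IH.
Qed.

(** Lagrange's form of the remainder for [s |-> Cexp (w s)] between 0 and 1. It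
    is only available for real functions, so that the real and imaginary parts
    are estimated at different intermediate points; hence the factor 2. *)
Lemma Cexp_taylor (w : C) (n : nat) :
  Cmod (Cexp w - sum_n (fun k => Cpow w k * RtoC (exp_coef k)) n)%C <=
  2 * (Cmod w ^ S n * exp (Cmod w) * exp_coef (S n)).
Proof.
assert (D : forall m t, Derive_n (fun s => Re (Cexp (w * RtoC s))) m t
   = Re (Cpow w m * Cexp (w * RtoC t))%C /\
   Derive_n (fun s => Im (Cexp (w * RtoC s))) m t
   = Im (Cpow w m * Cexp (w * RtoC t))%C) by (intros; apply Derive_n_Cexp).
assert (Z : Cexp (w * RtoC 0) = RtoC 1).
{ rewrite <- Cexp_0; f_equal; ring. }
assert (W : Cexp (w * RtoC 1) = Cexp w) by (f_equal; ring).
assert (B : forall s, 0 < s < 1 ->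
  Cmod (Cpow w (S n) * Cexp (w * RtoC s)) <= Cmod w ^ S n * exp (Cmod w)).
{ intros s Hs; rewrite Cmod_mult, Cmod_pow, Cmod_Cexp.
  apply Rmult_le_compat_l; [apply pow_le, Cmod_ge_0|].
  apply exp_le_compat.
  apply Rle_trans with (1 := Rle_abs _), Rle_trans with (1 := re_le_Cmod _).
  rewrite Cmod_mult, Cmod_R, Rabs_pos_eq by lra.
  rewrite <- (Rmult_1_r (Cmod w)) at 2.
  apply Rmult_le_compat_l; [apply Cmod_ge_0 | lra]. }
assert (F : 0 < exp_coef (S n)) by apply Rinv_0_lt_compat, lt_0_INR, lt_O_fact.
set (S0 := sum_n _ n).
assert (T1 : Rabs (Re (Cexp w - S0)%C) <= Cmod w ^ S n * exp (Cmod w) * exp_coef (S n)).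
{ destruct (Taylor_Lagrange (fun s => Re (Cexp (w * RtoC s))) n 0 1 Rlt_0_1)
    as [s [Hs E]].
  { intros t _ k _; exact (proj1 (smooth_Cexp w k t)). }
  rewrite W, (proj1 (D _ _)) in E.
  assert (E' : Re (Cexp w - S0)%C = Re (Cpow w (S n) * Cexp (w * RtoC s))%C * exp_coef (S n)).
  { unfold S0; change (Re (Cexp w - ?x)%C) with (Re (Cexp w) - Re x); rewrite E, Re_sum_n.
    match goal with |- ?a + ?b - ?c = _ => assert (a = c) as -> end.
    - apply sum_eq; intros k _; rewrite (proj1 (D _ _)), Z, Rminus_0_r, pow1.
      unfold exp_coef, Rdiv; rewrite Rmult_1_l, Cmult_1_r.
      unfold Re; simpl; ring.
    - rewrite Rminus_0_r, pow1; unfold exp_coef, Rdiv; ring. }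
  rewrite E', Rabs_mult, (Rabs_pos_eq (exp_coef _)) by lra.
  apply Rmult_le_compat_r; [lra|].
  apply Rle_trans with (1 := re_le_Cmod _); now apply B. }
assert (T2 : Rabs (Im (Cexp w - S0)%C) <= Cmod w ^ S n * exp (Cmod w) * exp_coef (S n)).
{ destruct (Taylor_Lagrange (fun s => Im (Cexp (w * RtoC s))) n 0 1 Rlt_0_1)
    as [s [Hs E]].
  { intros t _ k _; exact (proj2 (smooth_Cexp w k t)). }
  rewrite W, (proj2 (D _ _)) in E.
  assert (E' : Im (Cexp w - S0)%C = Im (Cpow w (S n) * Cexp (w * RtoC s))%C * exp_coef (S n)).
  { unfold S0; change (Im (Cexp w - ?x)%C) with (Im (Cexp w) - Im x); rewrite E, Im_sum_n.
    match goal with |- ?a + ?b - ?c = _ => assert (a = c) as -> end.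
    - apply sum_eq; intros k _; rewrite (proj2 (D _ _)), Z, Rminus_0_r, pow1.
      unfold exp_coef, Rdiv; rewrite Rmult_1_l, Cmult_1_r.
      unfold Im; simpl; ring.
    - rewrite Rminus_0_r, pow1; unfold exp_coef, Rdiv; ring. }
  rewrite E', Rabs_mult, (Rabs_pos_eq (exp_coef _)) by lra.
  apply Rmult_le_compat_r; [lra|].
  apply Rle_trans with (1 := Im_le_Cmod _); now apply B. }
apply Rle_trans with (1 := Cmod_le_Re_Im _); lra.
Qed.

Lemma Cexp_order1 (w : C) :
  Cmod (Cexp w - 1 - w)%C <= Cmod w ^ 2 * exp (Cmod w).
Proof.
assert (H := Cexp_taylor w 1).
replace (Cexp w - 1 - w)%C with
  (Cexp w - sum_n (fun k => Cpow w k * RtoC (exp_coef k)) 1)%C.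
- apply Rle_trans with (1 := H); unfold exp_coef; simpl; right; field.
- rewrite sum_Sn, sum_O; unfold plus, exp_coef; simpl.
  rewrite Rinv_1; ring.
Qed.

(** The principal logarithm for [0 < Re p]; elsewhere the arctangent is not the
    argument of [p]. *)
Definition Clog (p : C) : C := (ln (Cmod p), atan (Im p / Re p)).

Lemma Cexp_Clog p : 0 < Re p -> Cexp (Clog p) = p.
Proof.
destruct p as [x y]; unfold Re at 1; simpl; intros Hx.
assert (Hm : 0 < Cmod (x, y)).
{ apply Rlt_le_trans with (2 := re_le_Cmod _); apply Rabs_pos_lt; simpl; lra. }
assert (Hs : sqrt (1 + (y / x)²) = Cmod (x, y) / x).
{ apply sqrt_lem_1.
  - assert (H := Rle_0_sqr (y / x)); lra.
  - apply Rlt_le, Rdiv_lt_0_compat; trivial.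
  - unfold Cmod; simpl.
    replace (sqrt (x * (x * 1) + y * (y * 1)) / x * (sqrt (x * (x * 1) + y * (y * 1)) / x))
      with (sqrt (x * (x * 1) + y * (y * 1)) * sqrt (x * (x * 1) + y * (y * 1)) / (x * x))
      by (field; lra).
    rewrite sqrt_def by nra; unfold Rsqr; field; lra. }
unfold Clog, Cexp, Re, Im; simpl; rewrite exp_ln by trivial.
rewrite cos_atan, sin_atan, Hs; f_equal; field; lra.
Qed.

(** The argument of [p^s] is [s] times that of [p], so it stays in
    [(- PI / 2, PI / 2)]: this path joins 1 to [p] within the half-plane. *)
Lemma Re_Cexp_Clog_pos p s : 0 <= s <= 1 -> 0 < Re (Cexp (RtoC s * Clog p)).
Proof.
intros Hs; unfold Clog, Cexp, Re, RtoC; simpl.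
apply Rmult_lt_0_compat; [apply exp_pos|].
destruct (atan_bound (Im p / Re p)) as [H1 H2].
assert (P := PI_RGT_0).
apply cos_gt_0; unfold Im, Re in *; simpl; nra.
Qed.

(** * Powers on the half-line *)

Lemma pow_plus_pos t z : 0 < t -> pow_plus t z = Cexp (z * RtoC (ln t))%C.
Proof. intros H; unfold pow_plus; destruct (Rlt_dec 0 t); [reflexivity | lra]. Qed.

Lemma pow_plus_neg t z : t <= 0 -> pow_plus t z = RtoC 0.
Proof. intros H; unfold pow_plus; destruct (Rlt_dec 0 t); [lra | reflexivity]. Qed.

Lemma pow_plus_plus t a b :
  0 < t -> pow_plus t (a + b)%C = (pow_plus t a * pow_plus t b)%C.
Proof.
intros H; rewrite !pow_plus_pos by trivial; rewrite <- Cexp_plus; f_equal; ring.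
Qed.

Lemma pow_plus_INR t n : 0 < t -> pow_plus t (RtoC (INR n)) = RtoC (t ^ n).
Proof.
intros H; rewrite pow_plus_pos, Cexp_mult_INR, RtoC_pow by trivial; f_equal.
unfold Cexp, Re, Im, RtoC; simpl; rewrite exp_ln, cos_0, sin_0 by trivial.
f_equal; ring.
Qed.

Lemma Cmod_pow_plus t z : 0 < t -> Cmod (pow_plus t z) = exp (Re z * ln t).
Proof.
intros H; rewrite pow_plus_pos, Cmod_Cexp by trivial; f_equal.
unfold Re, RtoC; simpl; ring.
Qed.

Lemma Cderiv_pow_plus t z :
  0 < t -> Cderiv (fun s => pow_plus s z) t (z * pow_plus t (z - 1))%C.
Proof.
intros H.
apply Cderiv_ext_loc with (fun s => Cexp (z * RtoC (ln s))%C).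
{ apply (filter_imp (fun s => 0 < s)); [|now apply locally_pos].
  intros s Hs; now rewrite pow_plus_pos. }
replace (z * pow_plus t (z - 1))%C with (z * RtoC (/ t) * Cexp (z * RtoC (ln t)))%C.
- apply (Cderiv_Cexp (fun s => z * RtoC (ln s))%C), Cderiv_scal_RtoC.
  now apply is_derive_ln.
- rewrite pow_plus_pos by trivial.
  replace ((z - 1) * ln t)%C with (z * ln t + - RtoC (ln t))%C by ring.
  rewrite Cexp_plus.
  replace (Cexp (- RtoC (ln t))%C) with (RtoC (/ t)); [ring|].
  unfold Cexp, Re, Im, RtoC; simpl; rewrite exp_Ropp, exp_ln by trivial.
  rewrite Ropp_0, cos_0, sin_0; f_equal; ring.
Qed.

Lemma Ccont_pow_plus t z : 0 < t -> Ccont (fun s => pow_plus s z) t.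
Proof. intros H; eapply Cderiv_cont, Cderiv_pow_plus; trivial. Qed.

Lemma pow_plus_small z eps :
  0 < Re z -> 0 < eps ->
  exists d, 0 < d /\ forall t, t < d -> Cmod (pow_plus t z) < eps.
Proof.
intros Hz He; exists (exp (ln eps / Re z)); split; [apply exp_pos|].
intros t Ht; destruct (Rlt_dec 0 t) as [P|P].
- rewrite Cmod_pow_plus by trivial.
  rewrite <- (exp_ln eps) by trivial; apply exp_increasing.
  assert (L : ln t < ln eps / Re z).
  { rewrite <- (ln_exp (ln eps / Re z)); now apply ln_increasing. }
  apply Rmult_lt_compat_l with (1 := Hz) in L.
  replace (Re z * (ln eps / Re z)) with (ln eps) in L by (field; lra); lra.
- rewrite pow_plus_neg, Cmod_0 by lra; trivial.
Qed.

Lemma Ccont_pow_plus_all t z : 0 < Re z -> Ccont (fun s => pow_plus s z) t.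
Proof.
intros Hz; destruct (Rtotal_order t 0) as [H|[->|H]].
- apply Ccont_ext_loc with (fun _ => RtoC 0); [|apply Ccont_const].
  apply (filter_imp (fun s => s < 0)); [|apply (open_lt 0 t H)].
  intros s Hs; now rewrite pow_plus_neg by lra.
- split; intros P [eps HP]; destruct (pow_plus_small z eps Hz (cond_pos eps))
    as [d [Hd B]]; exists (mkposreal d Hd); intros y Hy; apply HP;
  rewrite (pow_plus_neg 0) by lra;
  unfold ball in *; simpl in *; unfold AbsRing_ball, abs, minus, plus, opp in *; simpl in *;
  (assert (Hy' : y < d) by (apply Rabs_def2 in Hy; lra));
  specialize (B y Hy'); rewrite Ropp_0, Rplus_0_r.
  + apply Rle_lt_trans with (2 := B), re_le_Cmod.
  + apply Rle_lt_trans with (2 := B), Im_le_Cmod.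
- now apply Ccont_pow_plus.
Qed.

Lemma pow_plus_bound t z N :
  0 < t -> 0 <= Re z <= INR N -> Cmod (pow_plus t z) <= (1 + t) ^ N.
Proof.
intros Ht Hz; rewrite Cmod_pow_plus by trivial.
rewrite <- (exp_ln (1 + t)) by lra.
assert (E : exp (INR N * ln (1 + t)) = exp (ln (1 + t)) ^ N).
{ clear; induction N as [|N IH]; [simpl; now rewrite Rmult_0_l, exp_0|].
  rewrite S_INR, Rmult_plus_distr_r, exp_plus, IH; simpl; rewrite Rmult_1_l; ring. }
rewrite <- E; apply exp_le_compat.
assert (L1 : ln t < ln (1 + t)) by (apply ln_increasing; lra).
assert (L2 : 0 < ln (1 + t)) by (rewrite <- ln_1; apply ln_increasing; lra).
apply Rle_trans with (Re z * ln (1 + t)).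
- apply Rmult_le_compat_l; lra.
- apply Rmult_le_compat_r; lra.
Qed.

(** * The Laplace integral of a power *)

(** The weight [(1 + t)^(N + 2)] pays for the growth [(1 + t)^N] of
    [t^(nu - 1)] and leaves the integrable bound [B / (1 + t)^2]. The condition
    [1 <= Re nu] avoids the singularity at 0; smaller [Re nu] are reached
    afterwards by [is_int_by_parts]. *)
Lemma is_int_moment nu N h B :
  0 <= Re (nu - 1)%C <= INR N ->
  (forall t, 0 < t -> Ccont h t) ->
  (forall t, 0 < t -> (1 + t) ^ (N + 2) * Cmod (h t) <= B) ->
  exists l, is_int_0_infty (fun t => h t * pow_plus t (nu - 1))%C l /\ Cmod l <= B.
Proof.
intros Hnu Hc Hb; apply is_int_dominated.
- intros t Ht; apply Ccont_mult; [now apply Hc | now apply Ccont_pow_plus].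
- intros t Ht; rewrite Cmod_mult.
  assert (Q : 0 < (1 + t) ^ 2) by (apply pow_lt; lra).
  apply Rmult_le_reg_r with (1 := Q).
  replace (B * / (1 + t) ^ 2 * (1 + t) ^ 2) with B by (field; lra).
  apply Rle_trans with (2 := Hb t Ht).
  rewrite pow_add.
  assert (P := pow_plus_bound t (nu - 1) N Ht Hnu).
  assert (H0 := Cmod_ge_0 (h t)).
  assert (H : Cmod (h t) * Cmod (pow_plus t (nu - 1)) <= Cmod (h t) * (1 + t) ^ N)
    by now apply Rmult_le_compat_l.
  apply Rmult_le_compat_r with (r := (1 + t) ^ 2) in H; lra.
Qed.

Lemma Cmod_Cexp_linear p t : Cmod (Cexp (- p * RtoC t)) = exp (- Re p * t).
Proof. rewrite Cmod_Cexp; f_equal; unfold Re, RtoC; simpl; ring. Qed.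

Lemma nat_above x : exists N, x <= INR N.
Proof.
destruct (nfloor_ex (Rabs x) (Rabs_pos x)) as [n [_ Hn]].
exists (S n); rewrite S_INR; assert (H := Rle_abs x); lra.
Qed.

Definition power_Laplace (nu p : C) : C :=
  RInt_gen (V := C_R_CompleteNormedModule)
    (fun t => Cexp (- p * RtoC t) * pow_plus t (nu - 1))%C
    (at_right 0) (Rbar_locally p_infty).

Lemma power_Laplace_is_int nu p :
  1 <= Re nu -> 0 < Re p ->
  is_int_0_infty (fun t => Cexp (- p * RtoC t) * pow_plus t (nu - 1))%C
    (power_Laplace nu p).
Proof.
intros Hnu Hp; destruct (nat_above (Re (nu - 1))) as [N HN].
destruct (poly_exp_bound (Re p) (N + 2) Hp) as [B HB].
destruct (is_int_moment nu N (fun t => Cexp (- p * RtoC t)) B) as [l [Hl _]].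
- split; [unfold Re in *; simpl; lra | exact HN].
- intros t _; apply Ccont_Cexp_linear.
- intros t Ht; rewrite Cmod_Cexp_linear; apply HB; lra.
- unfold power_Laplace; rewrite (RInt_gen_of_is_int _ l); exact Hl.
Qed.

Lemma filterlim_Re_Im_0 (F : (R -> Prop) -> Prop) {FF : Filter F} (f : R -> C) :
  (forall eps, 0 < eps -> F (fun t => Cmod (f t) < eps)) ->
  filterlim (fun t => Re (f t)) F (locally 0) /\
  filterlim (fun t => Im (f t)) F (locally 0).
Proof.
intros H; split; apply filterlim_locally; intros eps;
  generalize (H eps (cond_pos eps)); apply filter_imp; intros t Ht;
  unfold ball; simpl; unfold AbsRing_ball, abs, minus, plus, opp; simpl;
  rewrite Ropp_0, Rplus_0_r; apply Rle_lt_trans with (2 := Ht);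
  [apply re_le_Cmod | apply Im_le_Cmod].
Qed.

Lemma pow_exp_small nu p eps :
  0 < Re nu -> 0 < Re p -> 0 < eps ->
  Rbar_locally p_infty
    (fun t => Cmod (Cexp (- p * RtoC t) * pow_plus t nu)%C < eps).
Proof.
intros Hnu Hp He.
destruct (nat_above (Re nu)) as [N HN].
destruct (poly_exp_bound (Re p) (N + 1) Hp) as [B HB].
exists (Rmax 0 (B / eps)); intros t Ht.
assert (H1 : 0 < t) by (apply Rle_lt_trans with (2 := Ht), Rmax_l).
assert (H2 : B / eps < t) by (apply Rle_lt_trans with (2 := Ht), Rmax_r).
rewrite Cmod_mult, Cmod_Cexp_linear.
assert (P : Cmod (pow_plus t nu) <= (1 + t) ^ N) by (apply pow_plus_bound; lra).
specialize (HB t ltac:(lra)); rewrite pow_add, pow_1 in HB.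
assert (E := exp_pos (- Re p * t)).
apply Rmult_lt_reg_r with (1 + t); [lra|].
apply Rle_lt_trans with B.
- apply Rle_trans with (2 := HB).
  apply Rmult_le_compat_l with (r := exp (- Re p * t)) in P; [|lra].
  apply Rmult_le_compat_r with (r := 1 + t) in P; lra.
- apply Rmult_lt_compat_r with (r := eps) in H2; trivial.
  unfold Rdiv in H2; rewrite Rmult_assoc, Rinv_l in H2 by lra; nra.
Qed.

(** The function [e^(-pt) t^nu] vanishes at both ends, so the integral of its
    derivative is 0. This carries convergence and formulas from [nu + 1] down to
    [nu], hence from [1 <= Re nu] to [0 < Re nu]. *)
Lemma is_int_by_parts nu p l :
  0 < Re nu -> 0 < Re p ->
  is_int_0_infty (fun t => Cexp (- p * RtoC t) * pow_plus t (nu + 1 - 1))%C l ->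
  is_int_0_infty (fun t => Cexp (- p * RtoC t) * pow_plus t (nu - 1))%C (p / nu * l)%C.
Proof.
intros Hnu Hp Hl.
assert (Nnu : nu <> RtoC 0) by (intros ->; unfold Re, RtoC in Hnu; simpl in Hnu; lra).
set (F := fun t => (Cexp (- p * RtoC t) * pow_plus t nu)%C).
destruct (filterlim_Re_Im_0 (at_right 0) F) as [L1 L2].
{ intros eps He; destruct (pow_plus_small nu eps Hnu He) as [d [Hd Hs]].
  exists (mkposreal d Hd); intros t Ht Ht'.
  unfold F; rewrite Cmod_mult, Cmod_Cexp_linear.
  apply Rle_lt_trans with (Cmod (pow_plus t nu)).
  - rewrite <- (Rmult_1_l (Cmod (pow_plus t nu))) at 2.
    apply Rmult_le_compat_r; [apply Cmod_ge_0|].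
    rewrite <- exp_0; apply exp_le_compat; nra.
  - apply Hs; unfold ball in Ht; simpl in Ht;
    unfold AbsRing_ball, abs, minus, plus, opp in Ht; simpl in Ht;
    apply Rabs_def2 in Ht; lra. }
destruct (filterlim_Re_Im_0 (Rbar_locally p_infty) F) as [L3 L4].
{ intros eps He; now apply pow_exp_small. }
assert (H : is_int_0_infty (fun t => - p * Cexp (- p * RtoC t) * pow_plus t nu
  + Cexp (- p * RtoC t) * (nu * pow_plus t (nu - 1)))%C (RtoC 0 - RtoC 0)%C).
{ apply is_int_antideriv with F; trivial.
  - intros t Ht; apply Cderiv_mult; [apply Cderiv_Cexp_linear | now apply Cderiv_pow_plus].
  - intros t Ht; apply Ccont_plus.
    + apply (Ccont_mult (fun t => - p * Cexp (- p * RtoC t))%C); [|now apply Ccont_pow_plus].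
      apply (Ccont_mult (fun _ => - p)%C); [apply Ccont_const | apply Ccont_Cexp_linear].
    + apply Ccont_mult; [apply Ccont_Cexp_linear|].
      apply (Ccont_mult (fun _ => nu)); [apply Ccont_const | now apply Ccont_pow_plus]. }
pose proof (is_int_lin _ _ _ _ (/ nu)%C (p / nu)%C H Hl) as H'.
replace (p / nu * l)%C with (/ nu * (0 - 0) + p / nu * l)%C by (field; trivial).
revert H'; apply is_int_ext; intros t Ht.
replace (nu + 1 - 1)%C with nu by ring; field; trivial.
Qed.

Lemma power_Laplace_shift nu p :
  1 <= Re nu -> 0 < Re p ->
  (p * power_Laplace (nu + 1) p = nu * power_Laplace nu p)%C.
Proof.
intros Hnu Hp.
assert (Nnu : nu <> RtoC 0) by (intros ->; unfold Re, RtoC in Hnu; simpl in Hnu; lra).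
assert (H : is_int_0_infty (fun t => Cexp (- p * RtoC t) * pow_plus t (nu - 1))%C
  (p / nu * power_Laplace (nu + 1) p)%C).
{ apply is_int_by_parts; try lra.
  apply power_Laplace_is_int; trivial; unfold Re in *; simpl; lra. }
rewrite (is_int_unique _ _ _ (power_Laplace_is_int nu p Hnu Hp) H).
field; trivial.
Qed.

(** Differentiation in [p] under the integral sign: by [Cexp_order1] the first
    order remainder of [q |-> e^(-qt)] at [p] is at most
    [|q - p|^2 t^2 e^(- t Re p / 2)], and this has a finite moment. *)
Lemma power_Laplace_order1 nu p :
  1 <= Re nu -> 0 < Re p ->
  exists K, forall q, Cmod (q - p)%C <= Re p / 2 ->
    Cmod (power_Laplace nu q - power_Laplace nu p
      + (q - p) * power_Laplace (nu + 1) p)%C <= K * Cmod (q - p)%C ^ 2.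
Proof.
intros Hnu Hp; destruct (nat_above (Re (nu - 1))) as [N HN].
destruct (poly_exp_bound (Re p / 2) (N + 2 + 2) ltac:(lra)) as [B HB].
exists B; intros q Hq.
assert (Hq' : 0 < Re q).
{ assert (H := re_le_Cmod (q - p)%C).
  replace (Re (q - p)%C) with (Re q - Re p) in H by (unfold Re; simpl; ring).
  assert (Rabs (Re q - Re p) <= Re p / 2) by lra.
  apply Rabs_le_between in H0; lra. }
set (h := fun t => (Cexp (- p * RtoC t) *
  (Cexp (- (q - p) * RtoC t) - 1 - - (q - p) * RtoC t))%C).
destruct (is_int_moment nu N h (B * Cmod (q - p)%C ^ 2)) as [l [Hl Hb]].
- split; [unfold Re in *; simpl; lra | exact HN].
- intros t _; unfold h; apply Ccont_mult; [apply Ccont_Cexp_linear|].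
  unfold Cminus at 1; apply Ccont_plus.
  + apply Ccont_plus; [apply Ccont_Cexp_linear | apply Ccont_const].
  + apply Ccont_ext_loc with (fun t => (q - p) * RtoC t)%C.
    * apply filter_forall; intros s; ring.
    * apply Ccont_mult; [apply Ccont_const | apply Ccont_RtoC, continuous_id].
- intros t Ht; unfold h; rewrite Cmod_mult, Cmod_Cexp_linear.
  assert (O := Cexp_order1 (- (q - p) * RtoC t)%C).
  rewrite Cmod_mult, Cmod_opp, Cmod_R, Rabs_pos_eq in O by lra.
  set (d := Cmod (q - p)%C) in *.
  assert (Hd : 0 <= d) by apply Cmod_ge_0.
  specialize (HB t ltac:(lra)); rewrite pow_add in HB.
  assert (E : exp (- Re p * t) * exp (d * t) <= exp (- (Re p / 2) * t)).
  { rewrite <- exp_plus; apply exp_le_compat; nra. }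
  assert (P : 0 < (1 + t) ^ (N + 2)) by (apply pow_lt; lra).
  assert (E0 := exp_pos (- (Re p / 2) * t)).
  assert (E1 := exp_pos (- Re p * t)).
  assert (S1 : exp (- Re p * t) * Cmod (Cexp (- (q - p) * RtoC t) - 1 - - (q - p) * RtoC t)%C
    <= (1 + t) ^ 2 * exp (- (Re p / 2) * t) * d ^ 2).
  { apply Rle_trans with (exp (- Re p * t) * ((d * t) ^ 2 * exp (d * t))).
    - apply Rmult_le_compat_l; lra.
    - replace (exp (- Re p * t) * ((d * t) ^ 2 * exp (d * t))) with
        (t ^ 2 * d ^ 2 * (exp (- Re p * t) * exp (d * t))) by ring.
      replace ((1 + t) ^ 2 * exp (- (Re p / 2) * t) * d ^ 2) with
        ((1 + t) ^ 2 * d ^ 2 * exp (- (Re p / 2) * t)) by ring.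
      apply Rmult_le_compat; try lra.
      + apply Rmult_le_pos; apply pow2_ge_0.
      + apply Rlt_le, Rmult_lt_0_compat; apply exp_pos.
      + apply Rmult_le_compat_r; [apply pow2_ge_0 | apply pow_incr; lra]. }
  apply Rmult_le_compat_l with (r := (1 + t) ^ (N + 2)) in S1; [|lra].
  apply Rle_trans with (1 := S1).
  apply Rmult_le_compat_r with (r := d ^ 2) in HB; [lra | apply pow2_ge_0].
- replace (power_Laplace nu q - power_Laplace nu p + (q - p) * power_Laplace (nu + 1) p)%C
    with l; [exact Hb|].
  symmetry; refine (is_int_unique _ _ _ _ Hl).
  pose proof (is_int_lin _ _ _ _ (RtoC 1) (- RtoC 1)%C (power_Laplace_is_int nu q Hnu Hq')
    (power_Laplace_is_int nu p Hnu Hp)) as I1.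
  assert (Hnu' : 1 <= Re (nu + 1)%C) by (unfold Re in *; simpl; lra).
  pose proof (is_int_lin _ _ _ _ (RtoC 1) (q - p)%C I1
    (power_Laplace_is_int (nu + 1) p Hnu' Hp)) as I2.
  replace (power_Laplace nu q - power_Laplace nu p + (q - p) * power_Laplace (nu + 1) p)%C
   with (1 * (1 * power_Laplace nu q + - (1) * power_Laplace nu p)
     + (q - p) * power_Laplace (nu + 1) p)%C by ring.
  revert I2; apply is_int_ext; intros t Ht; unfold h.
  replace (- (q - p) * RtoC t)%C with (- q * RtoC t + p * RtoC t)%C by ring.
  rewrite Cexp_plus.
  replace (nu + 1 - 1)%C with (nu - 1 + RtoC (INR 1))%C by (simpl; ring).
  rewrite pow_plus_plus, pow_plus_INR, pow_1 by trivial.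
  assert (E : (Cexp (- p * RtoC t) * Cexp (p * RtoC t))%C = RtoC 1).
  { rewrite <- Cexp_plus, <- Cexp_0; f_equal; ring. }
  replace (Cexp (- p * t) * (Cexp (- q * t) * Cexp (p * t) - 1 - (- q * t + p * t)))%C
    with ((Cexp (- p * t) * Cexp (p * t)) * Cexp (- q * t)
      - Cexp (- p * t) * (1 + (- q * t + p * t)))%C by ring.
  rewrite E; ring.
Qed.

Lemma is_derive_quadratic (r : R -> R) (s0 K : R) :
  r s0 = 0 -> locally s0 (fun s => Rabs (r s) <= K * (s - s0) ^ 2) ->
  is_derive r s0 0.
Proof.
intros H0 [d Hd]; apply is_derive_Reals; intros eps He.
assert (K0 : 0 < Rabs K + 1) by (assert (H := Rabs_pos K); lra).
assert (Hm : 0 < Rmin d (eps / (Rabs K + 1))).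
{ apply Rmin_pos; [apply cond_pos | now apply Rdiv_lt_0_compat]. }
exists (mkposreal _ Hm); intros h Hh Hb; simpl in Hb.
rewrite H0, !Rminus_0_r; unfold Rdiv; rewrite Rabs_mult, Rabs_inv.
assert (P := Rabs_pos_lt h Hh).
assert (Hb1 := Rlt_le_trans _ _ _ Hb (Rmin_l _ _)).
assert (Hb2 := Rlt_le_trans _ _ _ Hb (Rmin_r _ _)).
assert (B : Rabs (r (s0 + h)) <= K * (s0 + h - s0) ^ 2).
{ apply Hd; unfold ball; simpl; unfold AbsRing_ball, abs, minus, plus, opp; simpl.
  replace (s0 + h + - s0) with h by ring; exact Hb1. }
apply Rmult_lt_reg_r with (Rabs h); [lra|].
rewrite Rmult_assoc, Rinv_l, Rmult_1_r by lra.
apply Rle_lt_trans with (1 := B).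
replace (K * (s0 + h - s0) ^ 2) with (K * Rabs h * Rabs h).
- apply Rmult_lt_compat_r; trivial.
  apply Rle_lt_trans with (Rabs h * (Rabs K + 1)).
  + assert (H := Rle_abs K); nra.
  + apply Rmult_lt_compat_r with (r := Rabs K + 1) in Hb2; trivial.
    unfold Rdiv in Hb2; rewrite Rmult_assoc, Rinv_l in Hb2 by lra; lra.
- replace (s0 + h - s0) with h by ring; rewrite <- (pow2_abs h); ring.
Qed.

Lemma is_derive_lipschitz (f : R -> R) t d :
  is_derive f t d ->
  locally t (fun s => Rabs (f s - f t) <= (Rabs d + 1) * Rabs (s - t)).
Proof.
intros [_ H]; specialize (H t (fun P HP => HP) (mkposreal 1 Rlt_0_1)).
revert H; apply filter_imp; intros s H; simpl in H.
unfold norm, minus, plus, opp, scal in H; simpl in H; unfold abs, mult in H; simpl in H.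
change (s + - t) with (s - t) in H; change (f s + - f t) with (f s - f t) in H.
replace (f s - f t) with (f s - f t + - ((s - t) * d) + (s - t) * d) by ring.
apply Rle_trans with (1 := Rabs_triang _ _); rewrite (Rabs_mult (s - t) d); lra.
Qed.

Lemma Cderiv_lipschitz f t d :
  Cderiv f t d -> exists K, locally t (fun s => Cmod (f s - f t)%C <= K * Rabs (s - t)).
Proof.
intros [H1 H2]; apply is_derive_lipschitz in H1; apply is_derive_lipschitz in H2.
exists (Rabs (Re d) + 1 + (Rabs (Im d) + 1)).
generalize (filter_and _ _ H1 H2); apply filter_imp; intros s [A B].
apply Rle_trans with (1 := Cmod_le_Re_Im _).
unfold Re, Im in *; simpl in *; unfold Rminus in *; lra.
Qed.

(** Chain rule for a function [G] which is complex differentiable at [P t],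
    with derivative [D] and a quadratic remainder, along a path [P]. *)
Lemma Cderiv_comp_order1 (G : C -> C) P t d D K r :
  Cderiv P t d -> 0 < r ->
  (forall q, Cmod (q - P t)%C <= r ->
    Cmod (G q - G (P t) - (q - P t) * D)%C <= K * Cmod (q - P t)%C ^ 2) ->
  Cderiv (fun s => G (P s)) t (d * D)%C.
Proof.
intros HP Hr HG.
destruct (Cderiv_lipschitz _ _ _ HP) as [L HL].
set (rem := fun s => (G (P s) - G (P t) - (P s - P t) * D)%C).
assert (Z : rem t = RtoC 0) by (unfold rem; ring).
assert (Hrem : locally t (fun s => Cmod (rem s) <= (Rabs K * L ^ 2) * (s - t) ^ 2)).
{ assert (Hsmall : locally t (fun s => Cmod (P s - P t)%C <= r)).
  { assert (Hr' : 0 < r / (Rabs L + 1)).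
    { apply Rdiv_lt_0_compat; trivial; assert (H := Rabs_pos L); lra. }
    generalize (filter_and _ _ HL (locally_ball t (mkposreal _ Hr'))).
    apply filter_imp; intros s [A B].
    unfold ball in B; simpl in B; unfold AbsRing_ball, abs, minus, plus, opp in B;
      simpl in B.
    apply Rle_trans with (1 := A).
    assert (H := Rabs_pos L); assert (H' := Rle_abs L).
    assert (H2 := Rabs_pos (s - t)).
    change (s + - t) with (s - t) in B.
    apply Rmult_lt_compat_r with (r := Rabs L + 1) in B; [|lra].
    unfold Rdiv in B; rewrite Rmult_assoc, Rinv_l in B by lra; nra. }
  generalize (filter_and _ _ HL Hsmall); apply filter_imp; intros s [A B].
  apply Rle_trans with (1 := HG _ B).
  assert (H := Cmod_ge_0 (P s - P t)%C).
  apply Rle_trans with (Rabs K * Cmod (P s - P t)%C ^ 2).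
  - apply Rmult_le_compat_r; [apply pow2_ge_0 | apply Rle_abs].
  - rewrite Rmult_assoc; apply Rmult_le_compat_l; [apply Rabs_pos|].
    rewrite <- (pow2_abs (s - t)), <- Rpow_mult_distr; apply pow_incr; lra. }
assert (Drem : Cderiv rem t (RtoC 0)).
{ split; (apply is_derive_quadratic with (Rabs K * L ^ 2);
    [rewrite Z; reflexivity|]);
  revert Hrem; apply filter_imp; intros s Hs; apply Rle_trans with (2 := Hs);
  [apply re_le_Cmod | apply Im_le_Cmod]. }
assert (Dlin : Cderiv (fun s => P s * D)%C t (d * D)%C).
{ replace (d * D)%C with (d * D + P t * RtoC 0)%C by ring.
  apply (Cderiv_mult P (fun _ => D)); trivial.
  split; apply (@is_derive_const R_AbsRing R_NormedModule). }
destruct Drem as [R1 R2], Dlin as [D1 D2]; split.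
- apply is_derive_ext with (fun s => Re (G (P t) - P t * D)%C + (Re (rem s) + Re (P s * D)%C)).
  { intros s; unfold rem, Re; simpl; ring. }
  replace (Re (d * D)%C) with (0 + (0 + Re (d * D)%C)) by ring.
  apply (@is_derive_plus R_AbsRing R_NormedModule);
    [apply (@is_derive_const R_AbsRing R_NormedModule)|].
  now apply (@is_derive_plus R_AbsRing R_NormedModule).
- apply is_derive_ext with (fun s => Im (G (P t) - P t * D)%C + (Im (rem s) + Im (P s * D)%C)).
  { intros s; unfold rem, Im; simpl; ring. }
  replace (Im (d * D)%C) with (0 + (0 + Im (d * D)%C)) by ring.
  apply (@is_derive_plus R_AbsRing R_NormedModule);
    [apply (@is_derive_const R_AbsRing R_NormedModule)|].
  now apply (@is_derive_plus R_AbsRing R_NormedModule).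
Qed.

Lemma power_Laplace_1 nu : power_Laplace nu (RtoC 1) = Gamma_int nu.
Proof.
unfold power_Laplace, Gamma_int; f_equal; apply functional_extensionality; intros t.
f_equal; f_equal; ring.
Qed.

(** Along the path [s |-> p^s] from 1 to [p] the function
    [p^(nu s) L(t^(nu - 1))(p^s)] has derivative 0: differentiating the
    transform brings down [- L(t^nu)], which [power_Laplace_shift] converts
    back to [L(t^(nu - 1))]. *)
Lemma power_Laplace_rotate nu p :
  1 <= Re nu -> 0 < Re p ->
  power_Laplace nu p = (Cexp (- nu * Clog p) * Gamma_int nu)%C.
Proof.
intros Hnu Hp; set (w := Clog p).
set (P := fun s : R => Cexp (w * RtoC s)).
assert (HP : forall s, 0 <= s <= 1 -> 0 < Re (P s)).
{ intros s Hs; unfold P; rewrite Cmult_comm; now apply Re_Cexp_Clog_pos. }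
set (f := fun s : R => (Cexp (nu * w * RtoC s) * power_Laplace nu (P s))%C).
assert (D : forall s, 0 <= s <= 1 -> Cderiv f s (RtoC 0)).
{ intros s Hs.
  destruct (power_Laplace_order1 nu (P s) Hnu (HP s Hs)) as [K HK].
  assert (DP : Cderiv P s (w * P s)%C) by apply Cderiv_Cexp_linear.
  assert (DG : Cderiv (fun s => power_Laplace nu (P s)) s
    (w * P s * - power_Laplace (nu + 1) (P s))%C).
  { apply (Cderiv_comp_order1 (power_Laplace nu) P s _ _ K (Re (P s) / 2)); trivial.
    - assert (H := HP s Hs); lra.
    - intros q Hq; apply Rle_trans with (2 := HK q Hq); right; f_equal; ring. }
  pose proof (Cderiv_mult _ _ _ _ _ (Cderiv_Cexp_linear (nu * w) s) DG) as DD.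
  replace (RtoC 0) with (nu * w * Cexp (nu * w * s) * power_Laplace nu (P s) +
    Cexp (nu * w * s) * (w * P s * - power_Laplace (nu + 1) (P s)))%C; [exact DD|].
  transitivity (w * Cexp (nu * w * s) * (nu * power_Laplace nu (P s) -
    P s * power_Laplace (nu + 1) (P s)))%C; [ring|].
  rewrite power_Laplace_shift by auto; ring. }
assert (E : f 0 = f 1).
{ apply C_eq.
  - apply (eq_is_derive (fun s => Re (f s))); [|apply Rlt_0_1].
    intros s Hs; apply (proj1 (D s Hs)).
  - apply (eq_is_derive (fun s => Im (f s))); [|apply Rlt_0_1].
    intros s Hs; apply (proj2 (D s Hs)). }
unfold f, P in E.
replace (nu * w * 0)%C with (RtoC 0) in E by ring.
replace (w * 0)%C with (RtoC 0) in E by ring.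
rewrite Cexp_0, power_Laplace_1, !Cmult_1_r in E.
unfold w in E at 2; rewrite Cexp_Clog in E by trivial.
rewrite Cmult_1_l in E; rewrite E, Cmult_assoc, <- Cexp_plus.
replace (- nu * w + nu * w)%C with (RtoC 0) by ring.
rewrite Cexp_0; ring.
Qed.

(** * Density of exponential sums *)

(** This is the mean of [phi] for the binomial law with [n] trials of
    probability [x], computed by conditioning on one trial. The recursion
    replaces binomial sums: every property below is an induction on [n]. *)
Fixpoint bernstein (n : nat) (phi : nat -> C) (x : R) : C :=
  match n with
  | O => phi O
  | S m => (RtoC (1 - x) * bernstein m phi x
            + RtoC x * bernstein m (fun k => phi (S k)) x)%C
  end.

Fixpoint bernstein_R (n : nat) (phi : nat -> R) (x : R) : R :=
  match n with
  | O => phi O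
  | S m => (1 - x) * bernstein_R m phi x + x * bernstein_R m (fun k => phi (S k)) x
  end.

Lemma bernstein_minus_const n phi c x :
  (bernstein n phi x - c)%C = bernstein n (fun k => phi k - c)%C x.
Proof.
revert phi; induction n as [|n IH]; intros phi; [reflexivity|]; simpl.
rewrite <- !IH, RtoC_minus; ring.
Qed.

Lemma bernstein_le_R n phi x :
  0 <= x <= 1 -> Cmod (bernstein n phi x) <= bernstein_R n (fun k => Cmod (phi k)) x.
Proof.
intros Hx; revert phi; induction n as [|n IH]; intros phi; [apply Rle_refl|]; simpl.
apply Rle_trans with (1 := Cmod_triangle _ _).
rewrite !Cmod_mult, !Cmod_R, !Rabs_pos_eq by lra.
apply Rplus_le_compat; apply Rmult_le_compat_l; try lra; [apply IH|].
apply (IH (fun k => phi (S k))).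
Qed.

Lemma bernstein_R_le n phi psi x :
  0 <= x <= 1 -> (forall k, (k <= n)%nat -> phi k <= psi k) ->
  bernstein_R n phi x <= bernstein_R n psi x.
Proof.
intros Hx; revert phi psi; induction n as [|n IH]; intros phi psi H; simpl.
- now apply H.
- apply Rplus_le_compat; apply Rmult_le_compat_l; try lra; apply IH; intros k Hk;
    apply H; lia.
Qed.

(** The second moment of the binomial law about an arbitrary point [c]; the
    point must vary for the induction to go through. *)
Lemma bernstein_R_quadratic n a b c x :
  bernstein_R n (fun k => a + b * (INR k - c) ^ 2) x =
  a + b * (INR n * x * (1 - x) + (INR n * x - c) ^ 2).
Proof.
revert c; induction n as [|n IH]; intros c; [simpl; ring|].
assert (E : bernstein_R n (fun k => a + b * (INR (S k) - c) ^ 2) x =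
  bernstein_R n (fun k => a + b * (INR k - (c - 1)) ^ 2) x).
{ f_equal; apply functional_extensionality; intros k; rewrite S_INR; ring. }
cbn [bernstein_R]; rewrite E, !IH, S_INR; ring.
Qed.

Lemma Ccont_unif (v : R -> C) eps :
  (forall x, Ccont v x) -> 0 < eps ->
  exists d, 0 < d /\ forall x y, 0 <= x <= 1 -> 0 <= y <= 1 -> Rabs (y - x) < d ->
    Cmod (v y - v x)%C <= eps.
Proof.
intros Hv He.
assert (He2 : 0 < eps / 2) by lra.
destruct (unifcont_1d (fun x => Re (v x)) 0 1 (fun x _ => proj1 (Hv x)) (mkposreal _ He2))
  as [d1 H1].
destruct (unifcont_1d (fun x => Im (v x)) 0 1 (fun x _ => proj2 (Hv x)) (mkposreal _ He2))
  as [d2 H2].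
exists (Rmin d1 d2); split; [apply Rmin_pos; apply cond_pos|].
intros x y Hx Hy Hd.
assert (A1 := H1 x y Hx Hy (Rlt_le_trans _ _ _ Hd (Rmin_l _ _))).
assert (A2 := H2 x y Hx Hy (Rlt_le_trans _ _ _ Hd (Rmin_r _ _))).
apply NNPP in A1; apply NNPP in A2.
apply Rle_trans with (1 := Cmod_le_Re_Im _).
apply Rle_trans with (eps / 2 + eps / 2); [|lra].
apply Rplus_le_compat; apply Rlt_le; assumption.
Qed.

(** Bernstein's theorem. By Chebyshev's inequality the samples [k / n] at
    distance at least [d] from [x] have small weight; pointwise this is the
    bound of [|v (k / n) - v x|] by [eps / 2 + 2 M (k / n - x)^2 / d^2]. *)
Lemma bernstein_approx (v : R -> C) M eps :
  (forall x, Ccont v x) -> (forall x, 0 <= x <= 1 -> Cmod (v x) <= M) -> 0 < eps ->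
  exists n, forall x, 0 <= x <= 1 ->
    Cmod (v x - bernstein n (fun k => v (INR k / INR n)%R) x)%C <= eps.
Proof.
intros Hv HM He.
assert (He2 : 0 < eps / 2) by lra.
destruct (Ccont_unif v _ Hv He2) as [d [Hd Hu]].
assert (M0 : 0 <= M).
{ apply Rle_trans with (Cmod (v 0)); [apply Cmod_ge_0 | apply HM; lra]. }
(* Makes the variance term [2 M / (d^2 n)] at most [eps / 2]. *)
destruct (nat_above (4 * M / (d ^ 2 * eps))) as [m Hm].
exists (S m); intros x Hx; set (n := S m).
assert (Hn : 0 < INR n) by (apply lt_0_INR; unfold n; lia).
assert (Hd2 : 0 < d ^ 2) by now apply pow_lt.
rewrite <- Cmod_opp.
replace (- (v x - bernstein n (fun k => v (INR k / INR n)%R) x))%C with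
  (bernstein n (fun k => v (INR k / INR n)%R) x - v x)%C by ring.
rewrite bernstein_minus_const.
apply Rle_trans with (1 := bernstein_le_R _ _ _ Hx).
set (b := 2 * M / (d ^ 2 * INR n ^ 2)).
assert (Hb : 0 <= b).
{ apply Rdiv_le_0_compat; [lra|].
  apply Rmult_lt_0_compat; trivial; now apply pow_lt. }
apply Rle_trans with
  (bernstein_R n (fun k => eps / 2 + b * (INR k - INR n * x) ^ 2) x).
- apply bernstein_R_le; trivial; intros k Hk.
  assert (Hkn : 0 <= INR k / INR n <= 1).
  { split.
    - apply Rdiv_le_0_compat; trivial; apply pos_INR.
    - apply Rmult_le_reg_r with (1 := Hn); unfold Rdiv.
      rewrite Rmult_assoc, Rinv_l, Rmult_1_l, Rmult_1_r by lra; now apply le_INR. }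
  destruct (Rlt_dec (Rabs (INR k / INR n - x)) d) as [H|H].
  + assert (H' := Hu x _ Hx Hkn H).
    assert (0 <= b * (INR k - INR n * x) ^ 2) by (apply Rmult_le_pos; [lra | apply pow2_ge_0]).
    lra.
  + assert (B : Cmod (v (INR k / INR n)%R - v x)%C <= 2 * M).
    { unfold Cminus; apply Rle_trans with (1 := Cmod_triangle _ _).
      rewrite Cmod_opp; assert (A1 := HM _ Hx); assert (A2 := HM _ Hkn); lra. }
    apply Rle_trans with (1 := B).
    apply Rle_trans with (b * (INR k - INR n * x) ^ 2); [|lra].
    replace (b * (INR k - INR n * x) ^ 2) with (2 * M * (Rabs (INR k / INR n - x) ^ 2 / d ^ 2)).
    * rewrite <- (Rmult_1_r (2 * M)) at 1; apply Rmult_le_compat_l; [lra|].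
      apply Rmult_le_reg_r with (1 := Hd2); unfold Rdiv.
      rewrite Rmult_assoc, Rinv_l, Rmult_1_l, Rmult_1_r by lra.
      apply pow_incr; lra.
    * rewrite pow2_abs; unfold b; field; lra.
- rewrite bernstein_R_quadratic.
  replace (INR n * x - INR n * x) with 0 by ring.
  assert (Q : x * (1 - x) <= 1) by nra.
  assert (S1 : b * (INR n * x * (1 - x) + 0 ^ 2) <= eps / 2); [|lra].
  apply Rle_trans with (b * INR n).
  { apply Rmult_le_compat_l; trivial. nra. }
  replace (b * INR n) with (2 * M / (d ^ 2 * INR n)) by (unfold b; field; lra).
  assert (Hmn : 4 * M / (d ^ 2 * eps) <= INR n) by (unfold n; rewrite S_INR; lra).
  assert (H0 : 0 < d ^ 2 * eps) by now apply Rmult_lt_0_compat.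
  assert (H1 : 4 * M <= INR n * (d ^ 2 * eps)).
  { apply Rmult_le_compat_r with (r := d ^ 2 * eps) in Hmn; [|lra].
    unfold Rdiv in Hmn; rewrite Rmult_assoc, Rinv_l in Hmn by lra; lra. }
  assert (H2 : 0 < d ^ 2 * INR n) by now apply Rmult_lt_0_compat.
  apply Rmult_le_reg_r with (1 := H2); unfold Rdiv.
  rewrite Rmult_assoc, Rinv_l by lra; nra.
Qed.

Lemma Cexp_neg_real a t : Cexp (- RtoC a * RtoC t) = RtoC (exp (- (a * t))).
Proof.
unfold Cexp, Re, Im, RtoC; simpl.
replace (- a * t - - 0 * 0) with (- (a * t)) by ring.
replace (- a * 0 + - 0 * t) with 0 by ring.
rewrite cos_0, sin_0; f_equal; ring.
Qed.

(** [P] contains the linear span of the functions [e^(-t), e^(-2t), ...]. It is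
    a predicate, not a type of sums, so that it can carry along what is to be
    proved of these sums. *)
Definition exp_closed (P : (R -> C) -> Prop) : Prop :=
  (forall j, P (fun t => Cexp (- RtoC (INR (S j)) * RtoC t)%C)) /\
  (forall f g a b, P f -> P g -> P (fun t => a * f t + b * g t)%C).

(** In the variable [x = e^(-t)] the recursion defining [bernstein] multiplies
    by [x] and [1 - x], which moves [e^(-(j + 1) t)] to [e^(-(j + 2) t)]. *)
Lemma exp_closed_bernstein P n phi j :
  exp_closed P ->
  P (fun t => Cexp (- RtoC (INR (S j)) * RtoC t) * bernstein n phi (exp (- t)))%C.
Proof.
intros [Hexp Hlin]; revert phi j; induction n as [|n IH]; intros phi j.
- replace (fun t : R => _) with (fun t : R => phi O * Cexp (- RtoC (INR (S j)) * RtoC t)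
    + RtoC 0 * Cexp (- RtoC (INR (S j)) * RtoC t))%C.
  + now apply Hlin.
  + apply functional_extensionality; intros t; simpl bernstein; ring.
- pose proof (Hlin _ _ (RtoC 1) (- RtoC 1)%C (IH phi j) (IH phi (S j))) as H1.
  pose proof (Hlin _ _ (RtoC 1) (RtoC 1) H1 (IH (fun k => phi (S k)) (S j))) as H2.
  cbv beta in H2.
  replace (fun t : R => _) with (fun t : R =>
    (1 * (1 * (Cexp (- RtoC (INR (S j)) * RtoC t) * bernstein n phi (exp (- t)))
     + - (1) * (Cexp (- RtoC (INR (S (S j))) * RtoC t) * bernstein n phi (exp (- t))))
     + 1 * (Cexp (- RtoC (INR (S (S j))) * RtoC t)
       * bernstein n (fun k => phi (S k)) (exp (- t))))%C); [exact H2|].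
  apply functional_extensionality; intros t; cbn [bernstein].
  assert (E : Cexp (- RtoC (INR (S (S j))) * RtoC t)
    = (RtoC (exp (- t)) * Cexp (- RtoC (INR (S j)) * RtoC t))%C).
  { rewrite !Cexp_neg_real, <- RtoC_mult, <- exp_plus; do 2 f_equal.
    rewrite (S_INR (S j)); ring. }
  rewrite E, RtoC_minus; ring.
Qed.

Definition cutoff (r t : R) : R := (Rabs (r + 1 - t) - Rabs (r - t) + 1) / 2.

Lemma cutoff_1 r t : t <= r -> cutoff r t = 1.
Proof. intros H; unfold cutoff; rewrite !Rabs_pos_eq by lra; field. Qed.

Lemma cutoff_0 r t : r + 1 <= t -> cutoff r t = 0.
Proof. intros H; unfold cutoff; rewrite !Rabs_left1 by lra; field. Qed.

Lemma cutoff_bounds r t : 0 <= cutoff r t <= 1.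
Proof. unfold cutoff; unfold Rabs; destruct Rcase_abs, Rcase_abs; lra. Qed.

Lemma continuous_cutoff r t : continuous (cutoff r) t.
Proof.
assert (A : forall c, continuous (fun s => Rabs (c - s)) t).
{ intros c; apply continuous_comp; [|apply continuous_Rabs].
  apply (@continuous_minus _ _ R_NormedModule (fun _ => c) (fun s => s));
    [apply continuous_const | apply continuous_id]. }
apply continuous_ext with (fun s => (/ 2) * (Rabs (r + 1 - s) - Rabs (r - s) + 1)).
{ intros s; apply Rmult_comm. }
apply (@continuous_scal_r _ R_AbsRing R_NormedModule (/ 2)
  (fun s => Rabs (r + 1 - s) - Rabs (r - s) + 1)).
apply (@continuous_plus _ _ R_NormedModule (fun s => Rabs (r + 1 - s) - Rabs (r - s)));
  [|apply continuous_const].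
apply (@continuous_minus _ _ R_NormedModule (fun s => Rabs (r + 1 - s)));
  apply A.
Qed.

Lemma Ccont_comp_real h u t : continuous u t -> Ccont h (u t) -> Ccont (fun s => h (u s)) t.
Proof.
intros Hu [H1 H2]; split.
- now apply (continuous_comp u (fun s => Re (h s))).
- now apply (continuous_comp u (fun s => Im (h s))).
Qed.

(** Cut [h] off beyond a large [r]: the error is small because one more power
    of [1 + t] is bounded against [h] than in the conclusion. The truncated [h]
    is [e^(-t) v(e^(-t))] with [v] continuous, zero near 0, and the Bernstein
    polynomials of [v] approximate it uniformly. The factor [e^(-t)] kept in
    front both absorbs the weight [(1 + t)^K] and removes the constant
    exponential. *)
Lemma exp_sums_dense P h K B eps :
  exp_closed P ->
  (forall t, Ccont h t) ->
  (forall t, 0 <= t -> (1 + t) ^ S K * Cmod (h t) <= B) ->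
  0 < eps ->
  exists q, P q /\ forall t, 0 <= t -> (1 + t) ^ K * Cmod (h t - q t)%C <= eps.
Proof.
intros HP Hh HB He.
assert (B0 : 0 <= B).
{ apply Rle_trans with (2 := HB 0 (Rle_refl 0)); apply Rmult_le_pos;
    [apply pow_le; lra | apply Cmod_ge_0]. }
(* Beyond [r] the bound [B / (1 + t)] is at most [eps / 2]. *)
set (r := 2 * B / eps).
assert (Hr : 0 <= r) by (apply Rdiv_le_0_compat; lra).
destruct (poly_exp_bound 1 K Rlt_0_1) as [E HE].
assert (E0 : 1 <= E).
{ assert (H := HE 0 (Rle_refl 0)); rewrite Rmult_0_r, exp_0, Rplus_0_r, pow1 in H; lra. }
set (v := fun x => if Rle_dec x 0 then RtoC 0
  else (RtoC (/ x * cutoff r (- ln x)) * h (- ln x)%R)%C).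
assert (Hv : forall x, 0 < x -> v x = (RtoC (/ x * cutoff r (- ln x)) * h (- ln x)%R)%C).
{ intros x Hx; unfold v; destruct (Rle_dec x 0); [lra | reflexivity]. }
assert (Hv0 : forall x, x < exp (- (r + 1)) -> v x = RtoC 0).
{ intros x Hx; destruct (Rle_dec x 0) as [H|H].
  - unfold v; destruct (Rle_dec x 0); [reflexivity | lra].
  - assert (L : ln x < - (r + 1)).
    { rewrite <- (ln_exp (- (r + 1))); apply ln_increasing; lra. }
    rewrite Hv, cutoff_0 by lra.
    rewrite Rmult_0_r; ring. }
assert (Cv : forall x, Ccont v x).
{ intros x; destruct (Rlt_dec 0 x) as [H|H].
  - apply Ccont_ext_loc with (fun x => RtoC (/ x * cutoff r (- ln x)) * h (- ln x)%R)%C.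
    { apply (filter_imp (fun s => 0 < s)); [|now apply locally_pos].
      intros s Hs; now rewrite Hv. }
    assert (Cl : continuous (fun s => - ln s) x).
    { apply (@ex_derive_continuous R_AbsRing R_NormedModule); auto_derive; lra. }
    apply Ccont_mult.
    + apply Ccont_RtoC, (@continuous_mult R_UniformSpace R_AbsRing).
      * apply (@ex_derive_continuous R_AbsRing R_NormedModule); auto_derive; lra.
      * apply (continuous_comp (fun s => - ln s) (cutoff r)); trivial.
        apply continuous_cutoff.
    + now apply Ccont_comp_real.
  - apply Ccont_ext_loc with (fun _ => RtoC 0); [|apply Ccont_const].
    assert (Hx : x < exp (- (r + 1))) by (assert (Q := exp_pos (- (r + 1))); lra).
    apply (filter_imp (fun s => s < exp (- (r + 1)))); [|apply (open_lt _ _ Hx)].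
    intros s Hs; symmetry; now apply Hv0. }
assert (Mv : forall x, 0 <= x <= 1 -> Cmod (v x) <= exp (r + 1) * B).
{ intros x Hx.
  assert (Z : 0 <= exp (r + 1) * B) by (apply Rmult_le_pos; [apply Rlt_le, exp_pos | lra]).
  destruct (Rlt_dec x (exp (- (r + 1)))) as [H|H]; [rewrite Hv0, Cmod_0; trivial|].
  assert (Q := exp_pos (- (r + 1))).
  assert (Hx0 : 0 < x) by lra.
  rewrite Hv, Cmod_mult, Cmod_R by lra.
  assert (C1 := cutoff_bounds r (- ln x)).
  assert (I0 : 0 < / x) by now apply Rinv_0_lt_compat.
  rewrite Rabs_pos_eq by (apply Rmult_le_pos; lra).
  assert (L : 0 <= - ln x).
  { destruct (Req_dec x 1) as [->|N]; [rewrite ln_1; lra|].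
    assert (ln x < 0) by (rewrite <- ln_1; apply ln_increasing; lra). lra. }
  apply Rmult_le_compat; try (apply Rmult_le_pos; lra); try apply Cmod_ge_0.
  - apply Rle_trans with (/ x * 1); [apply Rmult_le_compat_l; lra|].
    rewrite Rmult_1_r, <- (Ropp_involutive (r + 1)), (exp_Ropp (- (r + 1))).
    apply Rinv_le_contravar; lra.
  - apply Rle_trans with (2 := HB _ L).
    rewrite <- (Rmult_1_l (Cmod _)) at 1.
    apply Rmult_le_compat_r; [apply Cmod_ge_0|].
    apply pow_R1_Rle; lra. }
destruct (bernstein_approx v _ (eps / (2 * E)) Cv Mv) as [n Hn].
{ apply Rdiv_lt_0_compat; lra. }
(* The index [j = 0], that is the factor [e^(-t)]. *)
exists (fun t => Cexp (- RtoC (INR 1) * RtoC t)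
  * bernstein n (fun k => v (INR k / INR n)%R) (exp (- t)))%C.
split; [now apply exp_closed_bernstein|].
intros t Ht; rewrite Cexp_neg_real; simpl INR; rewrite Rmult_1_l.
assert (X : 0 <= exp (- t) <= 1).
{ split; [apply Rlt_le, exp_pos|]; rewrite <- exp_0; apply exp_le_compat; lra. }
specialize (Hn _ X); revert Hn; set (b := bernstein _ _ _); intros Hn.
assert (Ev : (RtoC (exp (- t)) * v (exp (- t)))%C = (RtoC (cutoff r t) * h t)%C).
{ rewrite Hv by apply exp_pos; rewrite ln_exp, Ropp_involutive, RtoC_mult.
  assert (RtoC (exp (- t)) * RtoC (/ exp (- t)) = RtoC 1)%C as I1.
  { rewrite <- RtoC_mult, Rinv_r; trivial; apply Rgt_not_eq, exp_pos. }
  transitivity (RtoC (exp (- t)) * RtoC (/ exp (- t)) * (RtoC (cutoff r t) * h t))%C; [ring|].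
  rewrite I1; ring. }
replace (h t - RtoC (exp (- t)) * b)%C with
  (RtoC (1 - cutoff r t) * h t + RtoC (exp (- t)) * (v (exp (- t)) - b))%C
  by (rewrite RtoC_minus; transitivity (h t - RtoC (cutoff r t) * h t
    + RtoC (exp (- t)) * v (exp (- t)) - RtoC (exp (- t)) * b)%C; [ring|];
    rewrite Ev; ring).
assert (Q : 0 < (1 + t) ^ K) by (apply pow_lt; lra).
apply Rle_trans with ((1 + t) ^ K * (Cmod (RtoC (1 - cutoff r t) * h t)
  + Cmod (RtoC (exp (- t)) * (v (exp (- t)) - b))%C)).
{ apply Rmult_le_compat_l; [lra | apply Cmod_triangle]. }
assert (C1 := cutoff_bounds r t).
rewrite !Cmod_mult, !Cmod_R, !Rabs_pos_eq by lra.
assert (T1 : (1 + t) ^ K * ((1 - cutoff r t) * Cmod (h t)) <= eps / 2).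
{ destruct (Rle_dec t r) as [H|H]; [rewrite cutoff_1 by trivial; lra|].
  assert (H1 := HB t Ht); simpl in H1.
  assert (H0 := Cmod_ge_0 (h t)).
  set (a := (1 + t) ^ K * Cmod (h t)) in *.
  assert (Ha : 0 <= a) by (apply Rmult_le_pos; lra).
  assert (Ha' : (1 + t) * a <= B) by (unfold a; lra).
  replace ((1 + t) ^ K * ((1 - cutoff r t) * Cmod (h t))) with ((1 - cutoff r t) * a)
    by (unfold a; ring).
  apply Rle_trans with a; [nra|].
  assert (Hre : r * eps = 2 * B) by (unfold r; field; lra).
  apply Rmult_le_reg_l with (1 + t); [lra|].
  apply Rle_trans with (1 := Ha').
  assert (r * eps <= t * eps) by (apply Rmult_le_compat_r; lra).
  nra. }
assert (T2 : (1 + t) ^ K * (exp (- t) * Cmod (v (exp (- t)) - b)%C) <= eps / 2).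
{ specialize (HE t Ht); replace (- (1) * t) with (- t) in HE by ring.
  replace (eps / 2) with (E * (eps / (2 * E))) by (field; lra).
  rewrite <- Rmult_assoc; apply Rmult_le_compat; trivial.
  - apply Rmult_le_pos; lra.
  - apply Cmod_ge_0. }
lra.
Qed.

(** * The gamma function has no zero in the right half-plane *)

Lemma Re_minus_one nu : Re (nu - 1)%C = Re nu - 1.
Proof. reflexivity. Qed.

Lemma Re_plus_one nu : Re (nu + 1)%C = Re nu + 1.
Proof. reflexivity. Qed.

Lemma is_derive_exp_neg_pow m t :
  is_derive (fun s => - exp (- s ^ S m)) t (INR (S m) * exp (- t ^ S m) * t ^ m).
Proof.
auto_derive; trivial; simpl; ring.
Qed.

Lemma is_int_exp_neg_pow m :
  is_int_0_infty (fun t => RtoC (INR (S m) * exp (- t ^ S m) * t ^ m)) (RtoC 1).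
Proof.
replace (RtoC 1) with (RtoC 0 - RtoC (-1))%C by (rewrite <- RtoC_minus; f_equal; ring).
apply is_int_antideriv with (fun t => RtoC (- exp (- t ^ S m))).
- intros t _; split;
  [exact (is_derive_exp_neg_pow m t) | exact (@is_derive_const R_AbsRing R_NormedModule 0 t)].
- intros t _; apply Ccont_RtoC.
  apply (@ex_derive_continuous R_AbsRing R_NormedModule); auto_derive; trivial.
- unfold Re, RtoC; simpl fst.
  replace (-1) with (- exp (- 0 ^ S m)).
  + eapply filterlim_filter_le_1; [apply filter_le_within|].
    apply (@ex_derive_continuous R_AbsRing R_NormedModule (fun t => - exp (- t ^ S m))).
    eexists; apply is_derive_exp_neg_pow.
  + rewrite pow_i by lia; rewrite Ropp_0, exp_0; ring.
- exact (filterlim_const (F := at_right 0) (0 : R_UniformSpace)).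
- unfold Re, RtoC; simpl fst.
  apply filterlim_locally; intros eps.
  exists (Rmax 1 (/ eps)); intros t Ht.
  assert (H1 := Rle_lt_trans _ _ _ (Rmax_l _ _) Ht).
  assert (H2 := Rle_lt_trans _ _ _ (Rmax_r _ _) Ht).
  assert (Pe := cond_pos eps).
  unfold ball; simpl; unfold AbsRing_ball, abs, minus, plus, opp; simpl.
  rewrite Ropp_0, Rplus_0_r, Rabs_Ropp, Rabs_pos_eq by apply Rlt_le, exp_pos.
  rewrite exp_Ropp, <- (Rinv_inv eps).
  apply Rinv_lt_contravar.
  + apply Rmult_lt_0_compat; [now apply Rinv_0_lt_compat | apply exp_pos].
  + apply Rlt_trans with (1 := H2), Rlt_le_trans with (1 + t ^ S m).
    * assert (Q : t <= t ^ S m).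
      { rewrite <- (pow_1 t) at 1; apply Rle_pow; [lra | lia]. }
      lra.
    * apply Rlt_le, exp_ineq1; apply Rgt_not_eq, (pow_lt t (S m)); lra.
- exact (filterlim_const (F := Rbar_locally p_infty) (0 : R_UniformSpace)).
Qed.

Lemma le_1_plus_pow m t : 0 <= t -> t <= 1 + t ^ S m.
Proof.
intros Ht; assert (P := pow_le t (S m) Ht).
destruct (Rle_dec t 1) as [H|H]; [lra|].
assert (Q : t ^ 1 <= t ^ S m) by (apply Rle_pow; [lra | lia]).
rewrite pow_1 in Q; lra.
Qed.

(** If [Gamma nu = 0], then by [power_Laplace_rotate] the function [t^(nu - 1)]
    is orthogonal to all exponentials, hence by density to all rapidly
    decreasing continuous functions. But it is not orthogonal to
    [M t^(M - nu) e^(-t^M)], where [M = m + 1] exceeds [Re nu]: the product has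
    the primitive [- e^(-t^M)], so its integral is 1. *)
Lemma Gamma_int_neq_0_aux nu : 1 <= Re nu -> Gamma_int nu <> RtoC 0.
Proof.
intros Hnu HG.
destruct (nat_above (Re nu)) as [m Hm].
destruct (nat_above (Re (nu - 1))) as [N HN].
assert (HN' : 0 <= Re (nu - 1)%C <= INR N) by (rewrite Re_minus_one in *; lra).
set (P := fun q : R -> C => (forall t, Ccont q t) /\
  is_int_0_infty (fun t => q t * pow_plus t (nu - 1))%C (RtoC 0)).
assert (HP : exp_closed P).
{ split.
  - intros j; split; [intros t; apply Ccont_Cexp_linear|].
    assert (Hj : 0 < Re (RtoC (INR (S j)))) by (apply lt_0_INR; lia).
    pose proof (power_Laplace_is_int nu _ Hnu Hj) as H.
    rewrite power_Laplace_rotate, HG, Cmult_0_r in H by trivial; exact H.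
  - intros f g a b [Cf If] [Cg Ig]; split.
    + intros t; apply Ccont_plus.
      * apply (Ccont_mult (fun _ => a)); [apply Ccont_const | apply Cf].
      * apply (Ccont_mult (fun _ => b)); [apply Ccont_const | apply Cg].
    + pose proof (is_int_lin _ _ _ _ a b If Ig) as H.
      replace (a * 0 + b * 0)%C with (RtoC 0) in H by ring.
      revert H; apply is_int_ext; intros t _; ring. }
set (z := (RtoC (INR (S m)) - nu)%C).
assert (Hz : 0 < Re z <= INR (S m)).
{ unfold z; rewrite S_INR; unfold Re in *; simpl in *; lra. }
set (h := fun t => (RtoC (INR (S m) * exp (- t ^ S m)) * pow_plus t z)%C).
assert (Ch : forall t, Ccont h t).
{ intros t; apply Ccont_mult; [|now apply Ccont_pow_plus_all].
  apply Ccont_RtoC, (@ex_derive_continuous R_AbsRing R_NormedModule).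
  auto_derive; trivial. }
destruct (poly_exp_bound 1 (S (N + 2) + S m) Rlt_0_1) as [E HE].
assert (Hm0 : 0 < INR (S m)) by (apply lt_0_INR; lia).
assert (E0 : 0 <= E).
{ apply Rle_trans with (2 := HE 0 (Rle_refl 0)), Rmult_le_pos;
   [apply pow_le; lra | apply Rlt_le, exp_pos]. }
destruct (exp_sums_dense P h (N + 2) (INR (S m) * exp 1 * E) (/ 2) HP Ch) as [q [[Cq Iq] Hq]].
{ intros t Ht; unfold h.
  destruct (Req_dec t 0) as [->|Nt].
  - rewrite pow_plus_neg, Cmult_0_r, Cmod_0, Rmult_0_r by lra.
    apply Rmult_le_pos; trivial; apply Rlt_le, Rmult_lt_0_compat; trivial; apply exp_pos.
  - rewrite Cmod_mult, Cmod_R, Rabs_pos_eq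
      by (apply Rlt_le, Rmult_lt_0_compat; trivial; apply exp_pos).
    assert (B1 : Cmod (pow_plus t z) <= (1 + t) ^ S m) by (apply pow_plus_bound; lra).
    assert (B2 : exp (- t ^ S m) <= exp 1 * exp (- (1) * t)).
    { rewrite <- exp_plus; apply exp_le_compat; assert (L := le_1_plus_pow m t Ht); lra. }
    specialize (HE t Ht); rewrite pow_add in HE.
    assert (Q : 0 <= (1 + t) ^ S (N + 2)) by (apply pow_le; lra).
    assert (Q' : 0 <= (1 + t) ^ S m) by (apply pow_le; lra).
    assert (Q1 := exp_pos 1); assert (Q2 := exp_pos (- (1) * t)).
    apply Rle_trans with ((1 + t) ^ S (N + 2) *
      (INR (S m) * (exp 1 * exp (- (1) * t)) * (1 + t) ^ S m)).
    + apply Rmult_le_compat_l; trivial.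
      apply Rmult_le_compat; trivial; try apply Cmod_ge_0.
      * apply Rmult_le_pos; [lra | apply Rlt_le, exp_pos].
      * apply Rmult_le_compat_l; lra.
    + replace ((1 + t) ^ S (N + 2) *
      (INR (S m) * (exp 1 * exp (- (1) * t)) * (1 + t) ^ S m)) with
      (INR (S m) * exp 1 * ((1 + t) ^ S (N + 2) * (1 + t) ^ S m * exp (- (1) * t))) by ring.
      apply Rmult_le_compat_l; trivial; apply Rmult_le_pos; lra. }
{ lra. }
assert (Ih : is_int_0_infty (fun t => h t * pow_plus t (nu - 1))%C (RtoC 1)).
{ generalize (is_int_exp_neg_pow m); apply is_int_ext; intros t Ht; unfold h.
  rewrite <- Cmult_assoc, <- pow_plus_plus by trivial.
  replace (z + (nu - 1))%C with (RtoC (INR m))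
    by (unfold z; rewrite S_INR, RtoC_plus; ring).
  rewrite pow_plus_INR, <- RtoC_mult by trivial; reflexivity. }
destruct (is_int_moment nu N (fun t => h t - q t)%C (/ 2) HN') as [l [Il Bl]].
- intros t _; unfold Cminus; apply Ccont_plus; trivial.
  apply Ccont_ext_loc with (fun t => (- RtoC 1) * q t)%C.
  + apply filter_forall; intros s; ring.
  + apply (Ccont_mult (fun _ => - RtoC 1)%C); [apply Ccont_const | apply Cq].
- intros t Ht; apply Hq; lra.
- pose proof (is_int_lin _ _ _ _ (RtoC 1) (- RtoC 1)%C Ih Iq) as H.
  assert (El : l = RtoC 1).
  { apply (is_int_unique _ _ _ Il).
    replace (1 * 1 + - (1) * 0)%C with (RtoC 1) in H by ring.
    revert H; apply is_int_ext; intros t _; ring. }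
  rewrite El, Cmod_1 in Bl; lra.
Qed.

Lemma Gamma_int_shift nu :
  0 < Re nu -> Gamma_int nu = (Gamma_int (nu + 1) / nu)%C.
Proof.
intros Hnu.
assert (H1 : 0 < Re (RtoC 1)) by apply Rlt_0_1.
assert (Hnu' : 1 <= Re (nu + 1)%C) by (rewrite Re_plus_one; lra).
pose proof (is_int_by_parts nu _ _ Hnu H1 (power_Laplace_is_int (nu + 1) _ Hnu' H1)) as H.
rewrite <- power_Laplace_1; unfold power_Laplace at 1.
rewrite (RInt_gen_of_is_int _ _ H), power_Laplace_1; unfold Cdiv; ring.
Qed.

Lemma Gamma_int_neq_0 nu : 0 < Re nu -> Gamma_int nu <> RtoC 0.
Proof.
intros Hnu E.
assert (Nnu : nu <> RtoC 0) by (intros ->; unfold Re, RtoC in Hnu; simpl in Hnu; lra).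
apply (Gamma_int_neq_0_aux (nu + 1)); [rewrite Re_plus_one; lra|].
rewrite Gamma_int_shift in E by trivial.
replace (Gamma_int (nu + 1)) with (Gamma_int (nu + 1) / nu * nu)%C by (field; trivial).
rewrite E; ring.
Qed.

Lemma rGamma_half_plane nu : 0 < Re nu -> rGamma nu = (/ Gamma_int nu)%C.
Proof.
intros Hnu; unfold rGamma.
assert (E : Z.to_nat (up (- Re nu)) = O).
{ destruct (archimed (- Re nu)) as [_ H].
  assert (H' : IZR (up (- Re nu)) < 1) by lra.
  apply lt_IZR in H'; lia. }
rewrite E; simpl; unfold Cdiv; rewrite Cmult_1_l; f_equal; f_equal; ring.
Qed.

(** * Laplace transform of the powers *)

Lemma is_Laplace_PhiFun nu p :
  0 < Re nu -> 0 < Re p -> is_LaplaceFun (PhiFun nu) p (Cexp (- nu * Clog p)).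
Proof.
intros Hnu Hp.
assert (Nnu : nu <> RtoC 0) by (intros ->; unfold Re, RtoC in Hnu; simpl in Hnu; lra).
assert (Hnu' : 1 <= Re (nu + 1)%C) by (rewrite Re_plus_one; lra).
assert (NG := Gamma_int_neq_0 nu Hnu).
pose proof (is_int_scal _ _ (rGamma nu)
  (is_int_by_parts nu _ _ Hnu Hp (power_Laplace_is_int (nu + 1) _ Hnu' Hp))) as H.
rewrite power_Laplace_rotate, rGamma_half_plane in H by trivial.
replace (Gamma_int (nu + 1)) with (Gamma_int nu * nu)%C in H
  by (rewrite Gamma_int_shift by trivial; field; trivial).
replace (- (nu + 1) * Clog p)%C with (- nu * Clog p + - Clog p)%C in H by ring.
rewrite Cexp_plus, Cexp_opp, Cexp_Clog in H by trivial.
assert (Np : p <> RtoC 0) by (intros ->; unfold Re, RtoC in Hp; simpl in Hp; lra).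
unfold is_LaplaceFun, PhiFun.
replace (Cexp (- nu * Clog p)) with
  (/ Gamma_int nu * (p / nu * (Cexp (- nu * Clog p) * / p * (Gamma_int nu * nu))))%C
  by (field; auto).
revert H; apply is_int_ext; intros t _.
rewrite rGamma_half_plane by trivial; ring.
Qed.

(** * Entire functions *)

Lemma sum_n_Cmult (c : C) (u : nat -> C) n :
  sum_n (G := C_AbelianMonoid) (fun k => c * u k)%C n = (c * sum_n (G := C_AbelianMonoid) u n)%C.
Proof.
induction n as [|n IH]; [now rewrite !sum_O|].
rewrite !sum_Sn, IH; unfold plus; simpl; ring.
Qed.

Lemma entire_Cexp w : entire (fun z => Cexp (- z * w)%C).
Proof.
intros z0; set (c := Cexp (- z0 * w)).
exists (fun k => (c * (Cpow (- w) k * RtoC (exp_coef k)))%C), 1.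
split; [apply Rlt_0_1|]; intros z _.
set (x := ((z - z0) * - w)%C).
assert (Ez : Cexp (- z * w) = (c * Cexp x)%C).
{ unfold c, x; rewrite <- Cexp_plus; f_equal; ring. }
rewrite Ez; unfold is_pseries, is_series.
apply filterlim_ext with (fun n =>
  (c * sum_n (G := C_AbelianMonoid) (fun k => Cpow x k * RtoC (exp_coef k)) n)%C).
{ intros n; rewrite <- sum_n_Cmult; apply sum_n_ext; intros k.
  transitivity (Cpow (z - z0) k * (c * (Cpow (- w) k * RtoC (exp_coef k))))%C.
  - unfold x; rewrite Cpow_mult_l.
    match goal with |- ?a = ?b => change (@eq C a b) end; ring.
  - reflexivity. }
apply filterlim_locally; intros eps.
set (A := Cmod c * (2 * exp (Cmod x)) + 1).
assert (A0 : 0 < A).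
{ assert (H := Cmod_ge_0 c); assert (H' := exp_pos (Cmod x)); unfold A; nra. }
assert (HA : 0 < eps / A) by (apply Rdiv_lt_0_compat; [apply cond_pos | trivial]).
destruct (cv_speed_pow_fact (Cmod x) _ HA) as [N HN].
exists N; intros n Hn; apply C_NormedModule_mixin_compat1.
unfold minus, plus, opp; simpl.
replace (c * sum_n (G := C_AbelianMonoid) (fun k => x ^ k * exp_coef k) n + - (c * Cexp x))%C
  with (- (c * (Cexp x - sum_n (G := C_AbelianMonoid) (fun k => x ^ k * exp_coef k) n)))%C by ring.
rewrite Cmod_opp, Cmod_mult.
specialize (HN (S n) ltac:(lia)); unfold Rdist in HN; rewrite Rminus_0_r in HN.
assert (H := Rle_lt_trans _ _ _ (Rle_abs _) HN).
assert (T := Cexp_taylor x n).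
apply Rle_lt_trans with (Cmod c * (2 * (Cmod x ^ S n * exp (Cmod x) * exp_coef (S n)))).
{ apply Rmult_le_compat_l; [apply Cmod_ge_0 | exact T]. }
set (y := Cmod x ^ S n / INR (fact (S n))) in *.
replace (Cmod c * (2 * (Cmod x ^ S n * exp (Cmod x) * exp_coef (S n)))) with ((A - 1) * y)
  by (unfold A, y, exp_coef; field; apply INR_fact_neq_0).
assert (Y0 : 0 <= y).
{ apply Rdiv_le_0_compat; [apply pow_le, Cmod_ge_0 | apply lt_0_INR, lt_O_fact]. }
apply Rle_lt_trans with (A * y); [nra|].
apply Rmult_lt_reg_r with (/ A); [now apply Rinv_0_lt_compat|].
unfold Rdiv in H; replace (A * y * / A) with y by (field; lra); exact H.
Qed.

(** The vanishing is assumed on one side of 0 only, so the comparison of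
    derivatives at 0 is replaced by continuity. *)
Lemma PSeries_right_zero_0 a r :
  Rbar_lt 0 (CV_radius a) -> 0 < r -> (forall x, 0 < x < r -> PSeries a x = 0) ->
  a O = 0.
Proof.
intros Ha Hr Hx; rewrite <- PSeries_0.
destruct (Req_dec (PSeries a 0) 0) as [E|E]; trivial; exfalso.
assert (Hc : continuity_pt (PSeries a) 0) by (apply PSeries_continuity; now rewrite Rabs_R0).
destruct (Hc (Rabs (PSeries a 0)) (Rabs_pos_lt _ E)) as [d [Hd H]].
set (x := Rmin d r / 2).
assert (Hm : 0 < Rmin d r) by now apply Rmin_pos.
assert (H1 := Rmin_l d r); assert (H2 := Rmin_r d r).
assert (Hxx : 0 < x < r) by (unfold x; lra).
specialize (H x); simpl in H; unfold Rdist in H.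
rewrite Hx, !Rminus_0_r, Rminus_0_l, Rabs_Ropp in H by trivial.
apply (Rlt_irrefl (Rabs (PSeries a 0))), H; split.
- split; [exact I | lra].
- rewrite Rabs_pos_eq by lra; unfold x; lra.
Qed.

(** Once the constant term is known to be 0, divide by [x] and repeat. *)
Lemma PSeries_right_zero a r n :
  Rbar_lt 0 (CV_radius a) -> 0 < r -> (forall x, 0 < x < r -> PSeries a x = 0) ->
  a n = 0.
Proof.
revert a r; induction n as [|n IH]; intros a r Ha Hr Hx.
- now apply PSeries_right_zero_0 with r.
- assert (H0 := PSeries_right_zero_0 a r Ha Hr Hx).
  apply (IH (PS_decr_1 a) r); trivial; [now rewrite CV_radius_decr_1|].
  intros x Hxr; specialize (Hx x Hxr).
  rewrite PSeries_decr_1_aux in Hx by trivial.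
  apply Rmult_integral in Hx; destruct Hx; [lra | trivial].
Qed.

Lemma CV_radius_pos a x l : 0 < x -> is_pseries a x l -> Rbar_lt 0 (CV_radius a).
Proof.
intros Hx H.
apply Rbar_lt_le_trans with x; [exact Hx|].
apply Rbar_not_lt_le; intros Hlt.
rewrite <- (Rabs_pos_eq x) in Hlt by lra.
apply (CV_disk_outside a x Hlt).
apply is_pseries_R in H; apply ex_series_lim_0; now exists l.
Qed.

Lemma is_pseries_right_zero (a : nat -> R) (f : R -> R) r :
  0 < r -> (forall x, Rabs x < r -> is_pseries a x (f x)) ->
  (forall x, 0 < x < r -> f x = 0) -> forall x, Rabs x < r -> f x = 0.
Proof.
intros Hr Ha Hf x Hx.
assert (Hcv : Rbar_lt 0 (CV_radius a)).
{ apply CV_radius_pos with (r / 2) (f (r / 2)); [lra|]; apply Ha.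
  rewrite Rabs_pos_eq; lra. }
assert (Z : forall n, a n = 0).
{ intros n; apply PSeries_right_zero with r; trivial; intros y Hy.
  rewrite <- (Hf y Hy); apply is_pseries_unique, Ha; rewrite Rabs_pos_eq; lra. }
rewrite <- (is_pseries_unique _ _ _ (Ha x Hx)).
rewrite (PSeries_ext a (fun _ => 0)) by trivial; apply PSeries_const_0.
Qed.

Lemma is_pseries_C_components (a : nat -> C) (x : R) (l : C) :
  is_pseries (K := C_AbsRing) (V := C_NormedModule) a (RtoC x) l ->
  is_pseries (fun n => Re (a n)) x (Re l) /\ is_pseries (fun n => Im (a n)) x (Im l).
Proof.
intros H.
assert (E : forall n, sum_n (G := C_AbelianMonoid)
  (fun k => scal (V := C_NormedModule) (pow_n (K := C_AbsRing) (RtoC x) k) (a k)) n =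
  sum_n (G := C_AbelianMonoid) (fun k => RtoC (x ^ k) * a k)%C n).
{ intros n; apply sum_n_ext; intros k; rewrite RtoC_pow; reflexivity. }
split; intros P [eps HP].
- assert (A : locally (l : C_NormedModule) (fun y => P (Re y))).
  { exists eps; intros y [Hy _]; now apply HP. }
  generalize (H _ A); unfold filtermap; apply filter_imp; intros n Hn.
  rewrite E, Re_sum_n, <- sum_n_Reals in Hn.
  erewrite sum_n_ext; [exact Hn|]; intros k; simpl.
  rewrite pow_n_pow; unfold scal, Re, RtoC; simpl; unfold mult; simpl; ring.
- assert (A : locally (l : C_NormedModule) (fun y => P (Im y))).
  { exists eps; intros y [_ Hy]; now apply HP. }
  generalize (H _ A); unfold filtermap; apply filter_imp; intros n Hn.
  rewrite E, Im_sum_n, <- sum_n_Reals in Hn.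
  erewrite sum_n_ext; [exact Hn|]; intros k; simpl.
  rewrite pow_n_pow; unfold scal, Im, RtoC; simpl; unfold mult; simpl; ring.
Qed.

Lemma analytic_at_right_agree g1 g2 z0 :
  analytic_at g1 z0 -> analytic_at g2 z0 ->
  (forall x, 0 < x -> g1 (z0 + RtoC x)%C = g2 (z0 + RtoC x)%C) ->
  exists r, 0 < r /\ forall x, Rabs x < r -> g1 (z0 + RtoC x)%C = g2 (z0 + RtoC x)%C.
Proof.
intros [a [r1 [Hr1 Ha]]] [b [r2 [Hr2 Hb]]] Hx.
assert (Hr : 0 < Rmin r1 r2) by now apply Rmin_pos.
exists (Rmin r1 r2); split; trivial.
assert (S : forall x, Rabs x < Rmin r1 r2 ->
  is_pseries (K := C_AbsRing) (V := C_NormedModule) (PS_minus a b) (RtoC x)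
   (g1 (z0 + RtoC x) - g2 (z0 + RtoC x))%C).
{ intros x Hxr.
  assert (M1 := Rlt_le_trans _ _ _ Hxr (Rmin_l _ _)).
  assert (M2 := Rlt_le_trans _ _ _ Hxr (Rmin_r _ _)).
  assert (E : (z0 + RtoC x - z0)%C = RtoC x) by ring.
  specialize (Ha (z0 + RtoC x)%C); specialize (Hb (z0 + RtoC x)%C).
  rewrite E, Cmod_R in Ha, Hb.
  apply (is_pseries_minus (K := C_AbsRing) (V := C_NormedModule)); auto. }
assert (Z : forall x, 0 < x -> (g1 (z0 + RtoC x) - g2 (z0 + RtoC x))%C = RtoC 0).
{ intros x Hx0; rewrite Hx by trivial; ring. }
intros x Hxr.
assert (D : (g1 (z0 + RtoC x) - g2 (z0 + RtoC x))%C = RtoC 0).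
{ apply C_eq.
  - apply (is_pseries_right_zero (fun n => Re (PS_minus a b n))
      (fun x => Re (g1 (z0 + RtoC x) - g2 (z0 + RtoC x))%C) (Rmin r1 r2)); trivial.
    + intros y Hy; exact (proj1 (is_pseries_C_components _ _ _ (S y Hy))).
    + intros y Hy; rewrite Z by lra; reflexivity.
  - apply (is_pseries_right_zero (fun n => Im (PS_minus a b n))
      (fun x => Im (g1 (z0 + RtoC x) - g2 (z0 + RtoC x))%C) (Rmin r1 r2)); trivial.
    + intros y Hy; exact (proj2 (is_pseries_C_components _ _ _ (S y Hy))).
    + intros y Hy; rewrite Z by lra; reflexivity. }
replace (g1 (z0 + RtoC x)%C) with (g1 (z0 + RtoC x) - g2 (z0 + RtoC x) + g2 (z0 + RtoC x))%C
  by ring.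
rewrite D; ring.
Qed.

(** Move left along a horizontal line. The largest open half-line on which
    [g1] and [g2] agree has no endpoint, since the power series at an endpoint
    coincide on its right, hence also on its left. *)
Lemma entire_half_plane_unique g1 g2 :
  entire g1 -> entire g2 ->
  (forall z, 0 < Re z -> g1 z = g2 z) -> forall z, g1 z = g2 z.
Proof.
intros H1 H2 Hp z.
set (agree := fun s : R => g1 (s, Im z) = g2 (s, Im z)).
set (U := fun u : R => forall s, - u < s -> agree s).
assert (U0 : U 0) by (intros s Hs; apply Hp; unfold Re; simpl; lra).
destruct (classic (exists u, U u /\ - u < Re z)) as [[u [Hu Hz]]|N].
{ specialize (Hu _ Hz); unfold agree in Hu; now rewrite (surjective_pairing z). }
exfalso.
destruct (completeness U) as [m [Hub Hlub]].
{ exists (- Re z); intros u Hu; apply Rnot_lt_le; intros H; apply N; exists u; split;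
    [trivial | lra]. }
{ now exists 0. }
assert (Hm : forall s, - m < s -> agree s).
{ intros s Hs.
  destruct (classic (exists u, U u /\ - s < u)) as [[u [Hu Hus]]|N'].
  - apply Hu; lra.
  - exfalso; assert (m <= - s); [|lra]; apply Hlub; intros u Hu.
    apply Rnot_lt_le; intros H; apply N'; now exists u. }
destruct (analytic_at_right_agree g1 g2 (- m, Im z) (H1 _) (H2 _)) as [r [Hr Hg]].
{ intros x Hx.
  replace (((- m)%R, Im z) + RtoC x)%C with ((- m + x)%R, Im z)
    by (apply C_eq; unfold Re, Im, RtoC; simpl; ring).
  apply Hm; lra. }
assert (Um : U (m + r / 2)).
{ intros s Hs; destruct (Rlt_dec (- m) s) as [H|H]; [now apply Hm|].
  unfold agree; replace (s, Im z) with (((- m)%R, Im z) + RtoC (s + m))%C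
    by (apply C_eq; unfold Re, Im, RtoC; simpl; ring).
  apply Hg; apply Rabs_def1; lra. }
specialize (Hub _ Um); lra.
Qed.

(** [Cexp (- nu * Clog p)] is an entire function of [nu] extending the
    convergent integrals, and by [entire_half_plane_unique] the only one. *)
Lemma LPhi_eq lambda p : 0 < Re p -> LPhi lambda p = Cexp (- lambda * Clog p).
Proof.
intros Hp; unfold LPhi.
destruct (epsilon_spec (inhabits (RtoC 0)) (fun w => exists g : C -> C, entire g /\
  (forall nu : C, 0 < Re nu -> is_LaplaceFun (PhiFun nu) p (g nu)) /\ g lambda = w))
  as [g [Hg [HL E]]].
- exists (Cexp (- lambda * Clog p)), (fun z => Cexp (- z * Clog p)); split; [|split].
  + apply entire_Cexp.
  + intros nu Hnu; now apply is_Laplace_PhiFun.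
  + reflexivity.
- rewrite <- E.
  apply (entire_half_plane_unique g (fun z => Cexp (- z * Clog p))); trivial.
  + apply entire_Cexp.
  + intros nu Hnu; 
    exact (is_int_unique _ _ _ (HL nu Hnu) (is_Laplace_PhiFun nu p Hnu Hp)).
Qed.

(** * Test functions and distributions *)

Lemma Cderiv_lin f g t df dg a b :
  Cderiv f t df -> Cderiv g t dg ->
  Cderiv (fun s => a * f s + b * g s)%C t (a * df + b * dg)%C.
Proof.
assert (K : forall c, Cderiv (fun _ => c) t (RtoC 0)).
{ intros c; split; apply (@is_derive_const R_AbsRing R_NormedModule). }
intros Hf Hg.
destruct (Cderiv_mult _ _ _ _ _ (K a) Hf) as [F1 F2].
destruct (Cderiv_mult _ _ _ _ _ (K b) Hg) as [G1 G2].
replace (a * df + b * dg)%C with ((0 * f t + a * df) + (0 * g t + b * dg))%C by ring.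
split.
- exact (@is_derive_plus R_AbsRing R_NormedModule _ _ _ _ _ F1 G1).
- exact (@is_derive_plus R_AbsRing R_NormedModule _ _ _ _ _ F2 G2).
Qed.

Lemma Cderiv_CDerive_n f n t :
  smooth f -> Cderiv (CDerive_n f n) t (CDerive_n f (S n) t).
Proof.
intros Hf; destruct (Hf (S n) t) as [H1 H2]; cbn [ex_derive_n] in H1, H2.
split; apply Derive_correct; assumption.
Qed.

Lemma CDerive_n_lin f g a b n t :
  smooth f -> smooth g ->
  CDerive_n (fun s => a * f s + b * g s)%C n t =
  (a * CDerive_n f n t + b * CDerive_n g n t)%C.
Proof.
intros Hf Hg; revert t; induction n as [|n IH]; intros t.
- unfold CDerive_n; cbn [Derive_n]; unfold Re, Im; now rewrite <- !surjective_pairing.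
- destruct (Cderiv_lin _ _ _ _ _ a b (Cderiv_CDerive_n f n t Hf) (Cderiv_CDerive_n g n t Hg))
    as [H1 H2].
  apply C_eq; unfold CDerive_n at 1, Re at 1, Im at 1; cbn [fst snd Derive_n].
  + rewrite <- (is_derive_unique _ _ _ H1); apply Derive_ext; intros s.
    rewrite <- IH; reflexivity.
  + rewrite <- (is_derive_unique _ _ _ H2); apply Derive_ext; intros s.
    rewrite <- IH; reflexivity.
Qed.

Lemma smooth_lin f g a b :
  smooth f -> smooth g -> smooth (fun s => a * f s + b * g s)%C.
Proof.
intros Hf Hg [|n] t; [now split|].
destruct (Cderiv_lin _ _ _ _ _ a b (Cderiv_CDerive_n f n t Hf) (Cderiv_CDerive_n g n t Hg))
  as [H1 H2].
split; cbn [ex_derive_n].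
- eapply ex_derive_ext; [|eexists; exact H1].
  intros s; cbv beta; rewrite <- CDerive_n_lin by trivial; reflexivity.
- eapply ex_derive_ext; [|eexists; exact H2].
  intros s; cbv beta; rewrite <- CDerive_n_lin by trivial; reflexivity.
Qed.

Lemma decay_lin (f g : test) a b N :
  exists B, seminorm_le N (fun s => a * f s + b * g s)%C B.
Proof.
destruct (test_decay f N) as [Bf Hf], (test_decay g N) as [Bg Hg].
exists (Cmod a * Bf + Cmod b * Bg); intros k t Hk Ht.
rewrite CDerive_n_lin by apply test_smooth.
specialize (Hf k t Hk Ht); specialize (Hg k t Hk Ht).
assert (Q : 0 < (1 + t) ^ N) by (apply pow_lt; lra).
apply Rle_trans with ((1 + t) ^ N * (Cmod a * Cmod (CDerive_n f k t)
  + Cmod b * Cmod (CDerive_n g k t))).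
- apply Rmult_le_compat_l; [lra|].
  rewrite <- !Cmod_mult; apply Cmod_triangle.
- apply Rmult_le_compat_l with (r := Cmod a) in Hf; [|apply Cmod_ge_0].
  apply Rmult_le_compat_l with (r := Cmod b) in Hg; [|apply Cmod_ge_0].
  lra.
Qed.

Definition test_lin (a : C) (f : test) (b : C) (g : test) : test :=
  Test (fun s => a * f s + b * g s)%C
    (smooth_lin f g a b (test_smooth f) (test_smooth g)) (decay_lin f g a b).

Lemma pairing_test_lin (T : Defs.dist) a f b g :
  T (test_lin a f b g) = (a * T f + b * T g)%C.
Proof. now apply dist_linear. Qed.

Lemma CDerive_n_test_lin a f b g n t :
  CDerive_n (test_lin a f b g) n t = (a * CDerive_n f n t + b * CDerive_n g n t)%C.
Proof. apply CDerive_n_lin; apply test_smooth. Qed.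

Lemma CDerive_n_exp_test p n t :
  CDerive_n (exp_test p) n t =
  (Cpow (- proj1_sig p) n * Cexp (- proj1_sig p * RtoC t))%C.
Proof.
unfold CDerive_n; destruct (Derive_n_Cexp (- proj1_sig p)%C n t) as [H1 H2].
apply C_eq; [exact H1 | exact H2].
Qed.

Lemma dist_ext (S T : Defs.dist) : (forall f, S f = T f) -> S = T.
Proof.
intros H; apply functional_extensionality in H.
destruct S as [s s1 s2], T as [t t1 t2]; simpl in H; subst t.
f_equal; apply proof_irrelevance.
Qed.

Lemma seminorm_le_weaken N N' f B :
  (N <= N')%nat -> seminorm_le N' f B -> seminorm_le N f B.
Proof.
intros HN H k t Hk Ht; apply Rle_trans with (2 := H k t ltac:(lia) Ht).
apply Rmult_le_compat_r; [apply Cmod_ge_0 | apply Rle_pow; lra || lia].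
Qed.

(** ** Injectivity of the Laplace transform *)

(** The barrier [psi = phi + eps (1 + t)^(-k)] is nonincreasing because
    [1 <= k], and it tends to 0 at infinity; so it is nonnegative. *)
Lemma decay_integrate_lower (phi dphi : R -> R) k B eps t :
  (1 <= k)%nat -> 0 <= eps ->
  (forall s, 0 <= s -> is_derive phi s (dphi s)) ->
  (forall s, 0 <= s -> (1 + s) ^ S k * Rabs (dphi s) <= eps) ->
  (forall s, 0 <= s -> (1 + s) * Rabs (phi s) <= B) ->
  0 <= t -> - eps <= (1 + t) ^ k * phi t.
Proof.
intros Hk He Hd Hb HB Ht; apply Rnot_lt_le; intros Hlt.
set (psi := fun s => phi s + eps * / (1 + s) ^ k).
assert (Dpsi : forall s, 0 <= s ->
  is_derive psi s (dphi s - INR k * eps * / (1 + s) ^ S k)).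
{ intros s Hs.
  assert (H : is_derive (fun s => eps * / (1 + s) ^ k) s (- (INR k * eps * / (1 + s) ^ S k))).
  { assert (Q : (1 + s) ^ k <> 0) by (apply Rgt_not_eq, pow_lt; lra).
    auto_derive; [trivial|].
    destruct k as [|k]; [lia|]; change (pred (S k)) with k; simpl pow in *.
    field; split; [apply Rgt_not_eq, pow_lt|]; lra. }
  exact (@is_derive_plus R_AbsRing R_NormedModule _ _ _ _ _ (Hd s Hs) H). }
assert (Neg : forall s, 0 <= s -> dphi s - INR k * eps * / (1 + s) ^ S k <= 0).
{ intros s Hs; assert (Q : 0 < (1 + s) ^ S k) by (apply pow_lt; lra).
  specialize (Hb s Hs); assert (A := Rle_abs (dphi s)).
  assert (K1 : 1 <= INR k) by (apply (le_INR 1); lia).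
  assert (E : dphi s <= eps * / (1 + s) ^ S k).
  { apply Rmult_le_reg_l with (1 := Q).
    replace ((1 + s) ^ S k * (eps * / (1 + s) ^ S k)) with eps by (field; lra).
    apply Rle_trans with (2 := Hb), Rmult_le_compat_l; lra. }
  assert (I0 : 0 < / (1 + s) ^ S k) by now apply Rinv_0_lt_compat.
  assert (0 <= eps * / (1 + s) ^ S k) by (apply Rmult_le_pos; lra).
  nra. }
assert (Qt : 0 < (1 + t) ^ k) by (apply pow_lt; lra).
set (eta := - psi t).
assert (Heta : 0 < eta).
{ unfold eta, psi; apply Rmult_lt_reg_l with (1 := Qt).
  rewrite Rmult_0_r.
  replace ((1 + t) ^ k * - (phi t + eps * / (1 + t) ^ k)) with
    (- eps - (1 + t) ^ k * phi t) by (field; lra).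
  lra. }
(* If [psi t = - eta < 0], then [phi s <= - eta] for all later [s], against
   [|phi s| <= B / (1 + s)] at this point. *)
set (s := Rmax (t + 1) (B / eta)).
assert (S1 : t + 1 <= s) by apply Rmax_l.
assert (S2 : B / eta <= s) by apply Rmax_r.
destruct (MVT_gen psi t s (fun s => dphi s - INR k * eps * / (1 + s) ^ S k)) as [c [Hc E]].
{ intros x; rewrite Rmin_left by lra; intros Hx; apply Dpsi; lra. }
{ intros x; rewrite Rmin_left by lra; intros Hx.
  apply continuity_pt_filterlim, (@ex_derive_continuous R_AbsRing R_NormedModule).
  eexists; apply Dpsi; lra. }
rewrite Rmin_left in Hc by lra.
assert (L : psi s <= - eta).
{ assert (H := Neg c ltac:(lra)).
  assert ((dphi c - INR k * eps * / (1 + c) ^ S k) * (s - t) <= 0) by nra.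
  unfold eta; lra. }
assert (L2 : phi s <= psi s).
{ unfold psi; assert (0 <= eps * / (1 + s) ^ k); [|lra].
  apply Rmult_le_pos; trivial; apply Rlt_le, Rinv_0_lt_compat, pow_lt; lra. }
assert (H := HB s ltac:(lra)).
assert (A : eta <= Rabs (phi s)).
{ rewrite <- Rabs_Ropp; apply Rle_trans with (2 := Rle_abs _); lra. }
assert (H' : B <= s * eta).
{ apply Rmult_le_compat_r with (r := eta) in S2; [|lra].
  unfold Rdiv in S2; rewrite Rmult_assoc, Rinv_l in S2 by lra; lra. }
nra.
Qed.

Lemma decay_integrate (phi dphi : R -> R) k B eps t :
  (1 <= k)%nat -> 0 <= eps ->
  (forall s, 0 <= s -> is_derive phi s (dphi s)) ->
  (forall s, 0 <= s -> (1 + s) ^ S k * Rabs (dphi s) <= eps) ->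
  (forall s, 0 <= s -> (1 + s) * Rabs (phi s) <= B) ->
  0 <= t -> (1 + t) ^ k * Rabs (phi t) <= eps.
Proof.
intros Hk He Hd Hb HB Ht.
assert (Q : 0 < (1 + t) ^ k) by (apply pow_lt; lra).
assert (A1 := decay_integrate_lower phi dphi k B eps t Hk He Hd Hb HB Ht).
assert (A2 : - eps <= (1 + t) ^ k * - phi t).
{ apply (decay_integrate_lower (fun s => - phi s) (fun s => - dphi s) k B); trivial.
  - intros s Hs; exact (@is_derive_opp R_AbsRing R_NormedModule _ _ _ (Hd s Hs)).
  - intros s Hs; rewrite Rabs_Ropp; auto.
  - intros s Hs; rewrite Rabs_Ropp; auto. }
unfold Rabs; destruct (Rcase_abs (phi t)); lra.
Qed.

Lemma test_decay_1 (f : test) n :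
  exists B, forall s, 0 <= s -> (1 + s) * Cmod (CDerive_n f n s) <= B.
Proof.
destruct (test_decay f (S n)) as [B HB]; exists B; intros s Hs.
apply Rle_trans with (2 := HB n s ltac:(lia) Hs).
apply Rmult_le_compat_r; [apply Cmod_ge_0|].
rewrite <- (pow_1 (1 + s)) at 1; apply Rle_pow; lra || lia.
Qed.

(** Each integration from infinity costs one power of [1 + t]; starting from
    [2 N + 1], after [N] steps at least [N] powers remain, with an exponent that
    never falls below the 1 required by [decay_integrate]. *)
Lemma seminorm_of_top_derivative (u : test) N eps :
  0 <= eps ->
  (forall t, 0 <= t -> (1 + t) ^ (2 * N + 1) * Cmod (CDerive_n u N t) <= eps) ->
  seminorm_le N u (2 * eps).
Proof.
intros He H.
assert (A : forall i, (i <= N)%nat -> forall t, 0 <= t ->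
  (1 + t) ^ (2 * N + 1 - i) * Rabs (Re (CDerive_n u (N - i) t)) <= eps /\
  (1 + t) ^ (2 * N + 1 - i) * Rabs (Im (CDerive_n u (N - i) t)) <= eps).
{ induction i as [|i IH]; intros Hi t Ht.
  - rewrite !Nat.sub_0_r; split; apply Rle_trans with (2 := H t Ht);
      (apply Rmult_le_compat_l; [apply pow_le; lra|]);
      [apply re_le_Cmod | apply Im_le_Cmod].
  - destruct (test_decay_1 u (N - S i)) as [B HB].
    assert (E1 : (N - i)%nat = S (N - S i)) by lia.
    assert (E2 : (2 * N + 1 - i)%nat = S (2 * N + 1 - S i)) by lia.
    rewrite E1, E2 in IH; specialize (IH ltac:(lia)).
    split.
    + apply (decay_integrate (fun s => Re (CDerive_n u (N - S i) s))
       (fun s => Re (CDerive_n u (S (N - S i)) s)) _ B); trivial; try lia.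
      * intros s _; exact (proj1 (Cderiv_CDerive_n u _ s (test_smooth u))).
      * intros s Hs; exact (proj1 (IH s Hs)).
      * intros s Hs; apply Rle_trans with (2 := HB s Hs).
        apply Rmult_le_compat_l; [lra | apply re_le_Cmod].
    + apply (decay_integrate (fun s => Im (CDerive_n u (N - S i) s))
       (fun s => Im (CDerive_n u (S (N - S i)) s)) _ B); trivial; try lia.
      * intros s _; exact (proj2 (Cderiv_CDerive_n u _ s (test_smooth u))).
      * intros s Hs; exact (proj2 (IH s Hs)).
      * intros s Hs; apply Rle_trans with (2 := HB s Hs).
        apply Rmult_le_compat_l; [lra | apply Im_le_Cmod]. }
intros k t Hk Ht.
destruct (A (N - k)%nat ltac:(lia) t Ht) as [A1 A2].
replace (N - (N - k))%nat with k in A1, A2 by lia.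
set (m := (2 * N + 1 - (N - k))%nat) in *.
assert (Q : 0 < (1 + t) ^ m) by (apply pow_lt; lra).
apply Rle_trans with ((1 + t) ^ m * Cmod (CDerive_n u k t)).
- apply Rmult_le_compat_r; [apply Cmod_ge_0|].
  apply Rle_pow; [lra | unfold m; lia].
- apply Rle_trans with ((1 + t) ^ m *
    (Rabs (Re (CDerive_n u k t)) + Rabs (Im (CDerive_n u k t)))).
  + apply Rmult_le_compat_l; [lra | apply Cmod_le_Re_Im].
  + lra.
Qed.

Lemma Cmod_zero_of_small (z : C) M :
  (forall eps, 0 < eps -> Cmod z <= M * eps) -> z = RtoC 0.
Proof.
intros H; apply Cmod_eq_0; apply Rle_antisym; [|apply Cmod_ge_0].
apply Rnot_lt_le; intros Hz.
assert (K : 0 < Rabs M + 1) by (assert (Q := Rabs_pos M); lra).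
assert (He : 0 < Cmod z / (2 * (Rabs M + 1))) by (apply Rdiv_lt_0_compat; lra).
specialize (H _ He).
assert (L : M * (Cmod z / (2 * (Rabs M + 1))) <= (Rabs M + 1) * (Cmod z / (2 * (Rabs M + 1)))).
{ apply Rmult_le_compat_r; [lra|]; assert (Q := Rle_abs M); lra. }
replace ((Rabs M + 1) * (Cmod z / (2 * (Rabs M + 1)))) with (Cmod z / 2) in L by (field; lra).
lra.
Qed.

(** The set of [N]-th derivatives of test functions on which [S] and [T] agree
    contains all exponentials, as these are derivatives of their own multiples.
    So [f^(N)] is approximated by some [g^(N)] with [S g = T g], and both [S]
    and [T] are small on [f - g]. *)
Lemma Laplace_injective (S T : Defs.dist) :
  (forall p, Laplace S p = Laplace T p) -> S = T.
Proof.
intros HL; apply dist_ext; intros f.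
destruct (dist_continuous S) as [N1 [M1 H1]], (dist_continuous T) as [N2 [M2 H2]].
set (N := Nat.max N1 N2).
set (P := fun q : R -> C => exists g : test, S g = T g /\ forall t, CDerive_n g N t = q t).
assert (HP : exp_closed P).
{ split.
  - intros j.
    assert (Hj : 0 < Re (RtoC (INR (Datatypes.S j)))) by (apply lt_0_INR; lia).
    set (p := exist _ _ Hj : half_plane).
    assert (Np : (- RtoC (INR (Datatypes.S j)))%C <> RtoC 0).
    { intros E; apply (f_equal Re) in E; unfold Re, RtoC in *; simpl fst in *; lra. }
    assert (Npn : Cpow (- RtoC (INR (Datatypes.S j))) N <> RtoC 0).
    { now apply Cpow_nz. }
    exists (test_lin (/ Cpow (- RtoC (INR (Datatypes.S j))) N)%C (exp_test p) (RtoC 0) (exp_test p)).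
    split.
    + rewrite !pairing_test_lin; now rewrite (HL p : S (exp_test p) = T (exp_test p)).
    + intros t; rewrite CDerive_n_test_lin, CDerive_n_exp_test; cbn [p proj1_sig].
      field; trivial.
  - intros q1 q2 a b [g1 [E1 D1]] [g2 [E2 D2]]; exists (test_lin a g1 b g2); split.
    + now rewrite !pairing_test_lin, E1, E2.
    + intros t; now rewrite CDerive_n_test_lin, D1, D2. }
destruct (test_decay f (2 * N + 2)) as [B HB].
assert (E : (S f - T f)%C = RtoC 0).
{ apply Cmod_zero_of_small with (2 * (M1 + M2)); intros eps He.
  destruct (exp_sums_dense P (CDerive_n f N) (2 * N + 1) B eps HP) as [q [[g [Eg Dg]] Hq]];
    trivial.
  { intros t; exact (Cderiv_cont _ _ _ (Cderiv_CDerive_n f N t (test_smooth f))). }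
  { intros t Ht; replace (Datatypes.S (2 * N + 1)) with (2 * N + 2)%nat by lia.
    apply HB; lia || trivial. }
  set (u := test_lin (RtoC 1) f (- RtoC 1)%C g).
  assert (Hu : seminorm_le N u (2 * eps)).
  { apply seminorm_of_top_derivative; [lra|]; intros t Ht.
    apply Rle_trans with (2 := Hq t Ht); right; f_equal; f_equal.
    unfold u; rewrite CDerive_n_test_lin, Dg; ring. }
  assert (HS := H1 u _ (seminorm_le_weaken N1 N u _ ltac:(unfold N; lia) Hu)).
  assert (HT := H2 u _ (seminorm_le_weaken N2 N u _ ltac:(unfold N; lia) Hu)).
  replace (S f - T f)%C with (S u + - T u)%C
    by (unfold u; rewrite !pairing_test_lin, Eg; ring).
  apply Rle_trans with (1 := Cmod_triangle _ _); rewrite Cmod_opp; lra. }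
replace (S f) with (S f - T f + T f)%C by ring; rewrite E; ring.
Qed.

(** ** The distributions with Laplace transform [p^(-lambda)] *)

Lemma test_moment nu n N (f : test) B :
  0 <= Re (nu - 1)%C <= INR N -> seminorm_le (n + N + 2) f B ->
  exists l, is_int_0_infty (fun t => CDerive_n f n t * pow_plus t (nu - 1))%C l /\ Cmod l <= B.
Proof.
intros HN HB; apply is_int_moment with N; trivial.
- intros t _; exact (Cderiv_cont _ _ _ (Cderiv_CDerive_n f n t (test_smooth f))).
- intros t Ht; apply Rle_trans with (2 := HB n t ltac:(lia) (Rlt_le _ _ Ht)).
  apply Rmult_le_compat_r; [apply Cmod_ge_0 | apply Rle_pow; lra || lia].
Qed.

Definition moment (nu : C) (n : nat) (f : test) : C :=
  RInt_gen (V := C_R_CompleteNormedModule)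
    (fun t => CDerive_n f n t * pow_plus t (nu - 1))%C
    (at_right 0) (Rbar_locally p_infty).

Lemma moment_is_int nu n (f : test) :
  1 <= Re nu ->
  is_int_0_infty (fun t => CDerive_n f n t * pow_plus t (nu - 1))%C (moment nu n f).
Proof.
intros Hnu; destruct (nat_above (Re (nu - 1))) as [N HN].
destruct (test_decay f (n + N + 2)) as [B HB].
destruct (test_moment nu n N f B) as [l [Hl _]]; trivial.
{ rewrite Re_minus_one in *; lra. }
unfold moment; rewrite (RInt_gen_of_is_int _ l); exact Hl.
Qed.

(** With [nu = lambda + n] and [1 <= Re nu], the [n]-th derivative of the
    function [Phi_nu] is [f |-> (-1)^n / Gamma nu] times the moment of [f^(n)].
    On [e^(-pt)] the derivatives produce [(-p)^n], which cancels the extra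
    [p^(-n)] in [L(Phi_nu) = p^(-lambda - n)]. *)
Lemma power_dist_exists lambda :
  exists T : Defs.dist, forall p, Laplace T p = Cexp (- lambda * Clog (proj1_sig p)).
Proof.
(* Enough derivatives to make [t^(nu - 1)] bounded near 0. *)
destruct (nat_above (1 - Re lambda)) as [n Hn].
set (nu := (lambda + RtoC (INR n))%C).
assert (Hnu : 1 <= Re nu) by (unfold nu, Re in *; simpl; lra).
destruct (nat_above (Re (nu - 1))) as [N HN].
set (c := (Cpow (- RtoC 1) n / Gamma_int nu)%C).
set (T := fun f : test => (c * moment nu n f)%C).
assert (T1 : forall (f g h : test) (a b : C),
  (forall t : R, h t = (a * f t + b * g t)%C) -> T h = (a * T f + b * T g)%C).
{ intros f g h a b E; unfold T.
  replace (moment nu n h) with (a * moment nu n f + b * moment nu n g)%C; [ring|].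
  symmetry; apply is_int_unique with (1 := moment_is_int nu n h Hnu).
  generalize (is_int_lin _ _ _ _ a b (moment_is_int nu n f Hnu) (moment_is_int nu n g Hnu)).
  apply is_int_ext; intros t _.
  apply functional_extensionality in E; rewrite E, CDerive_n_lin by apply test_smooth.
  ring. }
assert (T2 : exists (N : nat) (M : R), forall (f : test) (B : R),
  seminorm_le N f B -> Cmod (T f) <= M * B).
{ exists (n + N + 2)%nat, (Cmod c); intros f B HB.
  destruct (test_moment nu n N f B) as [l [Hl Bl]]; trivial.
  { rewrite Re_minus_one in *; lra. }
  unfold T; rewrite Cmod_mult, (is_int_unique _ _ _ (moment_is_int nu n f Hnu) Hl).
  apply Rmult_le_compat_l; [apply Cmod_ge_0 | exact Bl]. }
exists (Dist T T1 T2); intros [p Hp]; unfold Laplace, T; simpl.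
set (e := exp_test _).
assert (E : moment nu n e = (Cpow (- p) n * power_Laplace nu p)%C).
{ apply is_int_unique with (1 := moment_is_int nu n e Hnu).
  generalize (is_int_scal _ _ (Cpow (- p) n) (power_Laplace_is_int nu p Hnu Hp)).
  apply is_int_ext; intros t _; unfold e; rewrite CDerive_n_exp_test; simpl; ring. }
rewrite E, power_Laplace_rotate by trivial.
assert (NG : Gamma_int nu <> RtoC 0) by (apply Gamma_int_neq_0; lra).
replace (- lambda * Clog p)%C with (- nu * Clog p + RtoC (INR n) * Clog p)%C
  by (unfold nu; ring).
rewrite Cexp_plus, Cexp_mult_INR, Cexp_Clog by trivial.
assert (S1 : (Cpow (- RtoC 1) n * Cpow (- p) n = Cpow p n)%C).
{ rewrite <- Cpow_mult_l; f_equal; ring. }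
rewrite <- S1; unfold c; field; trivial.
Qed.

Lemma Laplace_Phi lambda p :
  Laplace (Phi lambda) p = Cexp (- lambda * Clog (proj1_sig p)).
Proof.
rewrite <- LPhi_eq by exact (proj2_sig p).
unfold Phi, Laplace_inv.
apply (epsilon_spec (inhabits delta)
  (fun T : Defs.dist => forall p : half_plane, Laplace T p = LPhi lambda (proj1_sig p))).
destruct (power_dist_exists lambda) as [T HT]; exists T; intros q.
rewrite HT; symmetry; apply LPhi_eq; exact (proj2_sig q).
Qed.

Theorem theorem1p1 : forall lambda mu : C,
  star (Phi lambda) (Phi mu) = Phi (lambda + mu)%C /\
  ((lambda + mu)%C = RtoC 0 ->
     Phi (lambda + mu)%C = Phi (RtoC 0) /\ Phi (RtoC 0) = delta).
Proof.
intros lambda mu; split.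
- unfold star; unfold Phi at 3; f_equal; apply functional_extensionality; intros p.
  rewrite !Laplace_Phi, LPhi_eq by exact (proj2_sig p).
  rewrite <- Cexp_plus; f_equal; ring.
- intros E; rewrite E; split; trivial.
  apply Laplace_injective; intros p; rewrite Laplace_Phi.
  unfold Laplace, delta; simpl; f_equal; ring.
Qed.
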